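(* Let $F$ be a field of characteristic different from $2$ such that its canonical cyclotomic pro-$2$ pair satisfies $(G_F(2),\theta_F)\in\mathcal C$, where $\mathcal C$ is the elementary type class of cyclotomic pro-$2$ pairs. Then there exist intermediate fields $L,H$ of $F(2)/F$ such that there is an isomorphism of cyclotomic pro-$2$ pairs $$(G_F(2),\theta_F)\cong(G_L(2),\theta_L)\ast_2(G_H(2),\theta_H),$$ where $G_L(2)$ is a free pro-$2$ group and $R(H)=\dot H^2$.
   Context: All fields have characteristic different from $2$. For a field $E$: $\dot E=E\setminus\{0\}$, $\dot E^2=\{\alpha^2\mid\alpha\in\dot E\}$; $E(2)$ is the maximal $2$-extension of $E$ (maximal Galois extension with pro-$2$ Galois group) inside a fixed separable closure, and $G_E(2)=\operatorname{Gal}(E(2)/E)$. For an intermediate field $M$ of $E(2)/E$, $M(2)=E(2)$ and $G_M(2)=\operatorname{Gal}(E(2)/M)$. $D_E\langle 1,a\rangle=\{x^2+ay^2\neq 0\mid x,y\in E\}$, and the Kaplansky radical is $R(E)=\bigcap_{a\in\dot E}D_E\langle 1,a\rangle$. The trivial group is a free pro-$2$ group (of rank $0$). A cyclotomic pro-$2$ pair is a pair $(G,\theta)$ with $G$ a pro-$2$ group and $\theta:G\to\mathbb Z_2^\times$ a continuous homomorphism. A morphism $(G_1,\theta_1)\to(G_2,\theta_2)$ is a continuous homomorphism $\varphi:G_1\to G_2$ with $\theta_1=\theta_2\circ\varphi$; it is an isomorphism if $\varphi$ is an isomorphism of groups. For a field $E$, the canonical character $\theta_E:G_E(2)\to\mathbb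 Z_2^\times$ describes the action of $G_E(2)$ on the group $\mu_{2^\infty}\subseteq E(2)$ of $2$-power roots of unity: $\sigma(\zeta)=\zeta^{\theta_E(\sigma)}$. A pair is realizable if it is isomorphic to $(G_E(2),\theta_E)$ for some field $E$. Free pro-$2$ product of pairs: $(G_1,\theta_1)\ast_2(G_2,\theta_2)=(G_1\ast_2G_2,\theta)$, where $G_1\ast_2G_2$ is the coproduct in the category of pro-$2$ groups and $\theta$ is the unique continuous homomorphism with $\theta|_{G_i}=\theta_i$. Cyclotomic semidirect product: for a pair $(G,\theta)$ and $m\ge1$, $G$ acts on $\mathbb Z_2^m$ by $g\cdot z=\theta(g)z$, and the pair is $(\mathbb Z_2^m\rtimes_\theta G,\widetilde\theta)$ with $\widetilde\theta(z,g)=\theta(g)$. Both operations preserve realizability. A pro-$2$ group $G$ is a Demushkin group if $H^1(G,\mathbb F_2)$ is finite-dimensional, $H^2(G,\mathbb F_2)\cong\mathbb F_2$, and the cup product $H^1(G,\mathbb F_2)\times H^1(G,\mathbb F_2)\to H^2(G,\mathbb F_2)$ is a nondegenerate bilinear pairing (this includes $\mathbb Z/2$). A field $E$ is $2$-Demushkin if $G_E(2)$ is a Demushkin group. The elementary type class $\mathcal C$ is the smallest class of realizable cyclotomic pro-$2$ pairs (taken up to isomorphism) such that: (i) $(G_E(2),\theta_E)\in\mathcal C$ whenever $G_E(2)$ is a finitely generated free pro-$2$ group (including rank $0$, i.e. the trivial pair $(\{1\},1)$); (ii) $(G_E(2),\theta_E)\in\mathcal C$ whenever $E$ is a $2$-Demushkin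 field; (iii) $\mathcal C$ is closed under free pro-$2$ products of two pairs; (iv) if $(G,\theta)\in\mathcal C$ then $(\mathbb Z_2^m\rtimes_\theta G,\widetilde\theta)\in\mathcal C$ for every $m\geq1$. *)

(* Defs.v *)
From HB Require Import structures.
From mathcomp Require Import all_boot all_order all_algebra separable.
From mathcomp Require Import all_classical topology.

Set Implicit Arguments.
Unset Strict Implicit.
Unset Printing Implicit Defensive.

Import GRing.Theory.

Local Open Scope classical_set_scope.
Local Open Scope ring_scope.

(* Inverse limit of the rings Z/2^n: [u n] is the residue modulo [2 ^ n]; the
   coherence condition forces [u n < 2 ^ n]. *)
Definition coherent (u : nat -> nat) := forall n, u n = (u n.+1 %% 2 ^ n)%N.

Record Z2 := MkZ2 { residue : nat -> nat; _ : `[< coherent residue >] }.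

HB.instance Definition _ := [isSub for residue].
HB.instance Definition _ := [Choice of Z2 by <:].

Section Z2Ring.
Implicit Types u v w : Z2.

Lemma residueS u n : residue u n = (residue u n.+1 %% 2 ^ n)%N.
Proof. by move: n; apply/asboolP; exact: (valP u). Qed.

Lemma residue_mod u n : (residue u n %% 2 ^ n = residue u n)%N.
Proof. by rewrite residueS modn_mod. Qed.

Lemma residue_inj u v : (forall n, residue u n = residue v n) -> u = v.
Proof. by move=> uv; apply: val_inj; apply/funext. Qed.

Lemma coherent_mod (f : nat -> nat) :
  (forall n, f n.+1 = f n %[mod 2 ^ n])%N -> coherent (fun n => f n %% 2 ^ n)%N.
Proof.
move=> fn n; rewrite modn_dvdm; last by rewrite expnS dvdn_mull.
by rewrite fn.
Qed.

Definition mkZ2 (f : nat -> nat) (fn : (forall n, f n.+1 = f n %[mod 2 ^ n])%N) : Z2 :=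
  MkZ2 (introT (asboolP _) (coherent_mod fn)).

Lemma Z2_nat_subproof k : (forall n, k = k %[mod 2 ^ n])%N.
Proof. by []. Qed.

Lemma Z2_add_subproof u v :
  (forall n, residue u n.+1 + residue v n.+1
             = residue u n + residue v n %[mod 2 ^ n])%N.
Proof. by move=> n; rewrite (residueS u n) (residueS v n) modnDm. Qed.

Lemma Z2_mul_subproof u v :
  (forall n, residue u n.+1 * residue v n.+1
             = residue u n * residue v n %[mod 2 ^ n])%N.
Proof. by move=> n; rewrite (residueS u n) (residueS v n) modnMm. Qed.

Lemma Z2_opp_subproof u :
  (forall n, 2 ^ n.+1 - residue u n.+1 = 2 ^ n - residue u n %[mod 2 ^ n])%N.
Proof.
have le m : (residue u m <= 2 ^ m)%N.
  by rewrite -residue_mod ltnW // ltn_mod expn_gt0.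
move=> n; apply/eqP; rewrite -(eqn_modDr (residue u n.+1)) subnK ?le //.
rewrite -modnDmr -residueS subnK ?le // expnS modnMl modnn //.
Qed.

Definition Z2_nat k := mkZ2 (Z2_nat_subproof k).
Definition Z2_add u v := mkZ2 (Z2_add_subproof u v).
Definition Z2_mul u v := mkZ2 (Z2_mul_subproof u v).
Definition Z2_opp u := mkZ2 (Z2_opp_subproof u).

Lemma Z2_addA : associative Z2_add.
Proof.
by move=> u v w; apply: residue_inj => n; rewrite /residue /= modnDmr modnDml addnA.
Qed.

Lemma Z2_addC : commutative Z2_add.
Proof. by move=> u v; apply: residue_inj => n; rewrite /residue /= addnC. Qed.

Lemma Z2_add0 : left_id (Z2_nat 0) Z2_add.
Proof.
by move=> u; apply: residue_inj => n; rewrite {1}/residue /= mod0n residue_mod.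
Qed.

Lemma Z2_addN : left_inverse (Z2_nat 0) Z2_opp Z2_add.
Proof.
move=> u; apply: residue_inj => n; rewrite /residue /= mod0n modnDml subnK ?modnn //.
by rewrite -/(residue u n) -residue_mod ltnW // ltn_mod expn_gt0.
Qed.

Lemma Z2_mulA : associative Z2_mul.
Proof.
by move=> u v w; apply: residue_inj => n; rewrite /residue /= modnMmr modnMml mulnA.
Qed.

Lemma Z2_mulC : commutative Z2_mul.
Proof. by move=> u v; apply: residue_inj => n; rewrite /residue /= mulnC. Qed.

Lemma Z2_mul1 : left_id (Z2_nat 1) Z2_mul.
Proof.
by move=> u; apply: residue_inj => n; rewrite {1}/residue /= modnMml mul1n residue_mod.
Qed.

Lemma Z2_mulDl : left_distributive Z2_mul Z2_add.
Proof.
by move=> u v w; apply: residue_inj => n; rewrite /residue /= modnMml mulnDl modnDm.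
Qed.

Lemma Z2_oner_neq0 : Z2_nat 1 != Z2_nat 0.
Proof. by apply/eqP => /(congr1 (fun u => residue u 1)). Qed.

HB.instance Definition _ := GRing.isZmodule.Build Z2 Z2_addA Z2_addC Z2_add0 Z2_addN.
HB.instance Definition _ :=
  GRing.Zmodule_isComNzRing.Build Z2 Z2_mulA Z2_mulC Z2_mul1 Z2_mulDl Z2_oner_neq0.

Definition Z2_open (A : set Z2) :=
  forall u, A u -> exists n, forall v, residue v n = residue u n -> A v.

Lemma residue_le u v m n : (m <= n)%N ->
  residue u n = residue v n -> residue u m = residue v m.
Proof.
move=> /subnK <-; elim: (n - m)%N => //= k IH; rewrite addSn => uv; apply: IH.
by rewrite residueS uv -residueS.
Qed.

Lemma Z2_openT : Z2_open setT.
Proof. by move=> u _; exists 0%N. Qed.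

Lemma Z2_openI : setI_closed Z2_open.
Proof.
move=> A B Ao Bo u [/Ao[m Am] /Bo[n Bn]]; exists (maxn m n) => v uv.
by split; [apply/Am/(residue_le _ uv)/leq_maxl|apply/Bn/(residue_le _ uv)/leq_maxr].
Qed.

Lemma Z2_open_bigU (I : Type) (f : I -> set Z2) :
  (forall i, Z2_open (f i)) -> Z2_open (\bigcup_i f i).
Proof.
by move=> fo u [i _ /(fo i)[n fn]]; exists n => v /fn fv; exists i.
Qed.

HB.instance Definition _ :=
  isOpenTopological.Build Z2 Z2_openT Z2_openI Z2_open_bigU.

Lemma Z2_nbhsP u (A : set Z2) :
  nbhs u A <-> exists n, forall v, residue v n = residue u n -> A v.
Proof.
split=> [[B [Bo Bu BA]]|[n nA]].
  by have [n nB] := Bo _ Bu; exists n => v /nB /BA.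
exists [set v | residue v n = residue u n]; split=> //.
by move=> v /= vu; exists n => w ->.
Qed.

End Z2Ring.

Lemma Z2_cvgP (T : topologicalType) (f : T -> Z2) x :
  {for x, continuous f} <->
  forall n, \forall y \near x, residue (f y) n = residue (f x) n.
Proof.
split=> [fc n|fn A /Z2_nbhsP[n nA]].
  apply: (fc [set v | residue v n = residue (f x) n]).
  by apply/Z2_nbhsP; exists n.
by rewrite /= nbhs_simpl; apply: filterS (fn n) => y /nA.
Qed.

Lemma rV_cvgP (T : topologicalType) m (f : T -> 'rV[Z2]_m) x :
  {for x, continuous f} <->
  forall i n, \forall y \near x, residue (f y ord0 i) n = residue (f x ord0 i) n.
Proof.
split=> [fc i n|fn A [B BM BA]].
  apply: (fc [set v : 'rV__ | residue (v ord0 i) n = residue (f x ord0 i) n]).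
  exists (fun j k => [set z : Z2 | k = i -> residue z n = residue (f x ord0 i) n]).
    move=> j k; apply/Z2_nbhsP; exists n => v; rewrite !ord1 => + ki.
    by rewrite ki.
  by move=> v /(_ ord0 i); exact.
rewrite /= nbhs_simpl /=.
have : \forall y \near x, forall i, B ord0 i (f y ord0 i).
  apply: filter_forall => i; have /Z2_nbhsP[n nB] := BM ord0 i.
  by apply: filterS (fn i n) => y /nB.
by apply: filterS => y yB; apply: BA => j k; rewrite ord1.
Qed.

HB.mixin Record isTopologicalGroup G of Group G & Topological G := {
  mulg_continuous : continuous (fun xy : G * G => (xy.1 * xy.2)%g);
  invg_continuous : continuous (fun x : G => x^-1%g)
}.

#[short(type="topGroupType")]
HB.structure Definition TopologicalGroup :=
  {G of isTopologicalGroup G & Group G & Topological G}.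

Definition subgroup (G : groupType) (N : set G) :=
  [/\ N 1%g, forall x y, N x -> N y -> N (x * y)%g & forall x, N x -> N x^-1%g].

Definition normal_subgroup (G : groupType) (N : set G) :=
  subgroup N /\ forall x y, N x -> N (y^-1 * x * y)%g.

(* [t] enumerates representatives of the left cosets of [N]. *)
Definition has_index (G : groupType) (N : set G) (d : nat) :=
  exists t : 'I_d -> G, forall x, exists! i, N ((t i)^-1 * x)%g.

Definition pro2 (G : topGroupType) :=
  [/\ compact [set: G], hausdorff_space G, totally_disconnected [set: G] &
      forall N : set G, open N -> normal_subgroup N -> exists k, has_index N (2 ^ k)].

Definition continuous_hom (G H : topGroupType) (f : G -> H) :=
  continuous f /\ {morph f : x y / (x * y)%g}.

Definition topologically_fg (G : topGroupType) :=
  exists s : seq G, forall C : set G, closed C -> subgroup C ->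
    (forall x, x \in s -> C x) -> C = setT.

(* The restriction of [f] to [X] converges to 1. *)
Definition converges_to_1 (G : Type) (H : topGroupType) (X : set G) (f : G -> H) :=
  forall U : set H, nbhs 1%g U -> finite_set (X `&` [set x | ~ U (f x)]).

(* Only the values of [f] on the basis [X] matter. *)
Definition free_pro2_on (G : topGroupType) (X : set G) :=
  [/\ pro2 G, converges_to_1 X id &
      forall (T : topGroupType) (f : G -> T), pro2 T -> converges_to_1 X f ->
        exists! h : G -> T, continuous_hom h /\ forall x, X x -> h x = f x].

Definition free_pro2 (G : topGroupType) := exists X : set G, free_pro2_on X.

Section Cohomology.
Variable G : topGroupType.

(* The action on F_2 is trivial, so that the only 1-coboundary is 0 and H^1 is
   the space of 1-cocycles. *)
Definition H1 : set (G -> 'F_2) :=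
  [set chi | continuous (chi : G -> discrete_topology 'F_2) /\
             forall g h, chi (g * h)%g = chi g + chi h].

Definition cocycle2 : set (G * G -> 'F_2) :=
  [set f | continuous (f : G * G -> discrete_topology 'F_2) /\
           forall g h k, f (h, k) - f (g * h, k)%g + f (g, h * k)%g - f (g, h) = 0].

Definition coboundary2 : set (G * G -> 'F_2) :=
  [set f | exists2 c : G -> 'F_2, continuous (c : G -> discrete_topology 'F_2) &
           forall g h, f (g, h) = c h - c (g * h)%g + c g].

Definition cup (chi psi : G -> 'F_2) : G * G -> 'F_2 :=
  fun gh => chi gh.1 * psi gh.2.

Definition H1_finite_dimensional :=
  exists n (e : 'I_n -> G -> 'F_2), (forall i, H1 (e i)) /\
    forall chi, H1 chi -> exists a : 'I_n -> 'F_2,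
      forall g, chi g = \sum_(i < n) a i * e i g.

(* An isomorphism from H^2, the quotient of 2-cocycles by 2-coboundaries, to F_2
   is a surjective additive map on 2-cocycles whose kernel is the subspace of
   2-coboundaries. *)
Definition H2_isomorphic_F2 :=
  exists inv : (G * G -> 'F_2) -> 'F_2,
    [/\ forall f f', cocycle2 f -> cocycle2 f' -> inv (f \+ f') = inv f + inv f',
        forall a, exists2 f, cocycle2 f & inv f = a &
        forall f, cocycle2 f -> (inv f = 0 <-> coboundary2 f)].

Definition cup_nondegenerate :=
  (forall chi, H1 chi -> (forall psi, H1 psi -> coboundary2 (cup chi psi)) ->
     forall g, chi g = 0) /\
  (forall psi, H1 psi -> (forall chi, H1 chi -> coboundary2 (cup chi psi)) ->
     forall g, psi g = 0).

Definition demushkin :=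
  [/\ pro2 G, H1_finite_dimensional, H2_isomorphic_F2 & cup_nondegenerate].

End Cohomology.

(* A multiplicative map into Z_2 sending 1 to 1 takes its values in the group of
   units, so this is a continuous homomorphism to the units of Z_2. *)
Definition continuous_character (G : topGroupType) (theta : G -> Z2) :=
  [/\ continuous theta, theta 1%g = 1 &
      forall g h, theta (g * h)%g = theta g * theta h].

(* The underlying group is not required to be pro-2; all the members of the
   elementary type class defined below are. *)
Record cyclotomic_pair := CyclotomicPair {
  pair_group :> topGroupType;
  pair_char : pair_group -> Z2;
  pair_charP : continuous_character pair_char
}.

Definition pair_morphism (P Q : cyclotomic_pair) (f : P -> Q) :=
  continuous_hom f /\ forall g, pair_char g = pair_char (f g).

Definition pair_isomorphic (P Q : cyclotomic_pair) :=
  exists (f : P -> Q) (f' : Q -> P),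
    [/\ pair_morphism f, pair_morphism f', cancel f f' & cancel f' f].

(* [P] is the coproduct of [P1] and [P2] in the category of pro-2 groups, with the
   character extending those of [P1] and [P2]. *)
Definition is_free_product (P1 P2 P : cyclotomic_pair) :=
  [/\ pro2 P1, pro2 P2, pro2 P &
      exists (i1 : P1 -> P) (i2 : P2 -> P),
        [/\ pair_morphism i1, pair_morphism i2 &
            forall (T : topGroupType) (f1 : P1 -> T) (f2 : P2 -> T), pro2 T ->
              continuous_hom f1 -> continuous_hom f2 ->
              exists! f : P -> T, [/\ continuous_hom f, f \o i1 = f1 & f \o i2 = f2]]].

Section SemidirectProduct.
Variables (m : nat) (P : cyclotomic_pair).

Definition sdprod_type := ('rV[Z2]_m * P)%type.

HB.instance Definition _ := Topological.copy sdprod_type ('rV[Z2]_m * P)%type.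

Definition sdprod_one : sdprod_type := (0, 1%g).
Definition sdprod_mul (x y : sdprod_type) : sdprod_type :=
  (x.1 + pair_char x.2 *: y.1, (x.2 * y.2)%g).
Definition sdprod_inv (x : sdprod_type) : sdprod_type :=
  (- (pair_char x.2^-1%g *: x.1), x.2^-1%g).

Lemma sdprod_mulA : associative sdprod_mul.
Proof.
have [_ _ tM] := pair_charP P.
by move=> x y z; rewrite /sdprod_mul /= tM mulgA scalerDr scalerA addrA.
Qed.

Lemma sdprod_mul1 : left_id sdprod_one sdprod_mul.
Proof.
have [_ t1 _] := pair_charP P.
by case=> z g; rewrite /sdprod_mul /= t1 mul1g scale1r add0r.
Qed.

Lemma sdprod_1mul : right_id sdprod_one sdprod_mul.
Proof. by case=> z g; rewrite /sdprod_mul /= mulg1 scaler0 addr0. Qed.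

Lemma sdprod_mulV : left_inverse sdprod_one sdprod_inv sdprod_mul.
Proof. by case=> z g; rewrite /sdprod_mul /= mulVg addNr. Qed.

Lemma sdprod_Vmul : right_inverse sdprod_one sdprod_inv sdprod_mul.
Proof.
have [_ t1 tM] := pair_charP P.
by case=> z g; rewrite /sdprod_mul /= scalerN scalerA -tM mulgV t1 scale1r subrr.
Qed.

HB.instance Definition _ := isGroup.Build sdprod_type
  sdprod_mulA sdprod_mul1 sdprod_1mul sdprod_mulV sdprod_Vmul.

Local Notation S := sdprod_type.

Lemma sdprod_pairP (T : topologicalType) (f : T -> S) x :
  {for x, continuous (fun y => (f y).1)} -> {for x, continuous (fun y => (f y).2)} ->
  {for x, continuous f}.
Proof.
move=> f1 f2 A [[B C] [/= Bx Cx] BCA]; rewrite /= nbhs_simpl /=.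
have Bn : \forall y \near x, B (f y).1 by exact: (f1 _ Bx).
have Cn : \forall y \near x, C (f y).2 by exact: (f2 _ Cx).
by apply: filterS (filterI Bn Cn) => y [? ?]; apply: BCA.
Qed.

Lemma sdprod_fst_continuous : continuous (fun x : S => x.1).
Proof. by move=> x A xA; exists (A, setT); [split=> //; exact: filterT|case=> ? ? []]. Qed.

Lemma sdprod_snd_continuous : continuous (fun x : S => x.2).
Proof. by move=> x A xA; exists (setT, A); [split=> //; exact: filterT|case=> ? ? []]. Qed.

Lemma sdprod_mul_continuous : continuous (fun xy : S * S => (xy.1 * xy.2)%g).
Proof.
have [tc _ _] := pair_charP P.
move=> x.
have c1 : {for x, continuous (fun y : S * S => y.1)} by exact: cvg_fst.
have c2 : {for x, continuous (fun y : S * S => y.2)} by exact: cvg_snd.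
have c11 := continuous_comp c1 (@sdprod_fst_continuous _).
have c12 := continuous_comp c1 (@sdprod_snd_continuous _).
have c21 := continuous_comp c2 (@sdprod_fst_continuous _).
have c22 := continuous_comp c2 (@sdprod_snd_continuous _).
apply: sdprod_pairP => /=.
  apply/rV_cvgP => i n.
  have /Z2_cvgP/(_ n) tn := continuous_comp c12 (tc _).
  move/rV_cvgP/(_ i n): c11 => n11; move/rV_cvgP/(_ i n): c21 => n21.
  near=> y; rewrite !mxE /= /Z2_add /=.
  have e1 : residue (y.1.1 ord0 i) n = residue (x.1.1 ord0 i) n by near: y.
  have e2 : residue (y.2.1 ord0 i) n = residue (x.2.1 ord0 i) n by near: y.
  have e3 : residue (pair_char y.1.2) n = residue (pair_char x.1.2) n by near: y.
  by rewrite e1 e2 e3.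
have /= := continuous_comp (cvg_pair c12 c22) (@mulg_continuous P (x.1.2, x.2.2)).
exact.
Unshelve. all: by end_near. Qed.

Lemma sdprod_inv_continuous : continuous (fun x : S => x^-1%g).
Proof.
have [tc _ _] := pair_charP P.
move=> x.
have c1 := @sdprod_fst_continuous x; have c2 := @sdprod_snd_continuous x.
have c3 := continuous_comp c2 (@invg_continuous P _).
apply: sdprod_pairP => //=.
apply/rV_cvgP => i n.
have /Z2_cvgP/(_ n) tn := continuous_comp c3 (tc _).
move/rV_cvgP/(_ i n): c1 => n1.
near=> y; rewrite !mxE /=.
have e1 : residue (y.1 ord0 i) n = residue (x.1 ord0 i) n by near: y.
have e3 : residue (pair_char y.2^-1%g) n = residue (pair_char x.2^-1%g) n by near: y.
by rewrite e1 e3.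
Unshelve. all: by end_near. Qed.

HB.instance Definition _ := isTopologicalGroup.Build S
  sdprod_mul_continuous sdprod_inv_continuous.

Definition sdprod_char (x : S) : Z2 := pair_char x.2.

Lemma sdprod_charP : continuous_character sdprod_char.
Proof.
have [tc t1 tM] := pair_charP P; split=> [x|//|x y]; last exact: tM.
exact: (continuous_comp (@sdprod_snd_continuous x) (tc _)).
Qed.

Definition sdprod_pair : cyclotomic_pair := CyclotomicPair sdprod_charP.

End SemidirectProduct.

(* A subfield S of Om, given as [S : divringClosed Om], as a field in its own
   right. *)
Record subfield_type (Om : fieldType) (S : divringClosed Om) :=
  SubfieldElt { subfield_val : Om; _ : subfield_val \in S }.

Section SubfieldType.
Variables (Om : fieldType) (S : divringClosed Om).

HB.instance Definition _ := [isSub of subfield_type S for @subfield_val Om S].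
HB.instance Definition _ := [Choice of subfield_type S by <:].
HB.instance Definition _ := [SubChoice_isSubIntegralDomain of subfield_type S by <:].
HB.instance Definition _ := [SubIntegralDomain_isSubField of subfield_type S by <:].

End SubfieldType.

Section GaloisGroup.
Variables (Om : fieldType) (K M : divringClosed Om).
Notation KT := (subfield_type K).

Definition is_automorphism (f : KT -> KT) :=
  [/\ f 1 = 1, {morph f : x y / x + y}, {morph f : x y / x * y}, bijective f &
      forall x : KT, val x \in M -> f x = x].

Record gal := Gal { gal_fun :> KT -> KT; _ : `[< is_automorphism gal_fun >] }.

HB.instance Definition _ := [isSub for gal_fun].
HB.instance Definition _ := [Choice of gal by <:].

Implicit Types s t : gal.

Lemma galP s : is_automorphism s. Proof. by apply/asboolP; exact: (valP s). Qed.

Lemma gal_ext s t : s =1 t -> s = t.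
Proof. by move=> st; apply: val_inj; apply/funext. Qed.

Lemma gal_one_subproof : is_automorphism id.
Proof. by split=> //; exists id. Qed.

Lemma gal_mul_subproof s t : is_automorphism (s \o t).
Proof.
have [s1 sD sM sb sf] := galP s; have [t1 tD tM tb tf] := galP t.
split=> [|x y|x y||x xM] /=; rewrite ?t1 ?tD ?tM //; first exact: bij_comp.
by rewrite (tf x) ?sf.
Qed.

Lemma gal_inv_exists s : exists g : KT -> KT, cancel s g /\ cancel g s.
Proof. by have [_ _ _ [g sg gs] _] := galP s; exists g. Qed.

Definition gal_inv_fun s : KT -> KT := projT1 (cid (gal_inv_exists s)).

Lemma gal_funK s : cancel s (gal_inv_fun s).
Proof. by rewrite /gal_inv_fun; case: cid => g []. Qed.

Lemma gal_invK s : cancel (gal_inv_fun s) s.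
Proof. by rewrite /gal_inv_fun; case: cid => g []. Qed.

Lemma gal_inv_subproof s : is_automorphism (gal_inv_fun s).
Proof.
have [s1 sD sM sb sf] := galP s; have inj := bij_inj sb.
split=> [|x y|x y||x xM]; last by apply: inj; rewrite gal_invK sf.
- by apply: inj; rewrite gal_invK s1.
- by apply: inj; rewrite sD !gal_invK.
- by apply: inj; rewrite sM !gal_invK.
- by exists s; [exact: gal_invK|exact: gal_funK].
Qed.

Definition gal_one := Gal (introT (asboolP _) gal_one_subproof).
Definition gal_mul s t := Gal (introT (asboolP _) (gal_mul_subproof s t)).
Definition gal_inv s := Gal (introT (asboolP _) (gal_inv_subproof s)).

Lemma gal_mulA : associative gal_mul.
Proof. by move=> s t u; apply: gal_ext. Qed.

Lemma gal_mul1 : left_id gal_one gal_mul.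
Proof. by move=> s; apply: gal_ext. Qed.

Lemma gal_1mul : right_id gal_one gal_mul.
Proof. by move=> s; apply: gal_ext. Qed.

Lemma gal_mulV : left_inverse gal_one gal_inv gal_mul.
Proof. by move=> s; apply: gal_ext => x /=; rewrite gal_funK. Qed.

Lemma gal_Vmul : right_inverse gal_one gal_inv gal_mul.
Proof. by move=> s; apply: gal_ext => x /=; rewrite gal_invK. Qed.

HB.instance Definition _ := isGroup.Build gal
  gal_mulA gal_mul1 gal_1mul gal_mulV gal_Vmul.

(* The Krull topology: the automorphisms agreeing with [s] on a finite set [X]
   form the coset of Gal(K/M(X)) containing [s]. *)
Definition gal_open (A : set gal) :=
  forall s, A s -> exists X : seq KT, forall t, {in X, t =1 s} -> A t.

Lemma gal_openT : gal_open setT. Proof. by move=> s _; exists [::]. Qed.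

Lemma gal_openI : setI_closed gal_open.
Proof.
move=> A B Ao Bo s [/Ao[X XA] /Bo[Y YB]]; exists (X ++ Y) => t ts.
by split; [apply: XA|apply: YB] => x xX; apply: ts; rewrite mem_cat xX ?orbT.
Qed.

Lemma gal_open_bigU (I : Type) (f : I -> set gal) :
  (forall i, gal_open (f i)) -> gal_open (\bigcup_i f i).
Proof. by move=> fo s [i _ /(fo i)[X Xf]]; exists X => t /Xf ft; exists i. Qed.

HB.instance Definition _ :=
  isOpenTopological.Build gal gal_openT gal_openI gal_open_bigU.

Lemma gal_nbhsP s (A : set gal) :
  nbhs s A <-> exists X : seq KT, forall t, {in X, t =1 s} -> A t.
Proof.
split=> [[B [Bo Bs BA]]|[X XA]].
  by have [X XB] := Bo _ Bs; exists X => t /XB /BA.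
exists [set t : gal | {in X, t =1 s}]; split=> //.
by move=> t /= ts; exists X => u ut x xX; rewrite ut // ts.
Qed.

Lemma gal_mul_continuous : continuous (fun st : gal * gal => (st.1 * st.2)%g).
Proof.
case=> s t A /gal_nbhsP[X XA].
exists ([set s' : gal | {in map t X, s' =1 s}], [set t' : gal | {in X, t' =1 t}]).
  by split; apply/gal_nbhsP; [exists (map t X)|exists X].
case=> s' t' [/= s's t't]; apply: XA => x xX /=.
by rewrite t't // s's // map_f.
Qed.

Lemma gal_inv_continuous : continuous (fun s : gal => s^-1%g).
Proof.
move=> s A /gal_nbhsP[X XA]; apply/gal_nbhsP; exists (map (gal_inv_fun s) X).
move=> t ts; apply: XA => x xX /=.
have [_ _ _ /bij_inj inj _] := galP t; apply: inj.
by rewrite gal_invK ts ?map_f // gal_invK.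
Qed.

HB.instance Definition _ := isTopologicalGroup.Build gal
  gal_mul_continuous gal_inv_continuous.

(* [residue (theta s) n] is the residue of [theta s] modulo [2 ^ n], which is the
   order of a group of roots of unity containing [zeta]. *)
Definition is_canonical_character (theta : gal -> Z2) :=
  continuous_character theta /\
  forall s n (zeta : KT), zeta ^+ (2 ^ n) = 1 -> s zeta = zeta ^+ residue (theta s) n.

(* There is exactly one canonical character as soon as K contains primitive 2^n-th
   roots of unity for all n, which is the case when the characteristic is not 2 and
   K is the maximal 2-extension of a field; the default value is then irrelevant. *)
Definition canonical_character : gal -> Z2 :=
  xget (fun=> 1) is_canonical_character.

Lemma canonical_characterP : continuous_character canonical_character.
Proof.
rewrite /canonical_character; case: xgetP => [theta _ []//|_].
by split=> [s|//|s t]; [exact: cst_continuous|rewrite mulr1].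
Qed.

Definition galois_pair : cyclotomic_pair := CyclotomicPair canonical_characterP.

End GaloisGroup.

Section Maximal2Extension.
Variables (Om : fieldType) (E : divringClosed Om).

Definition lift_poly (p : {poly subfield_type E}) : {poly Om} := map_poly val p.

Definition separable_over (x : Om) :=
  exists2 p : {poly subfield_type E}, separable_poly p & root (lift_poly p) x.

Definition separable_closure :=
  (forall x, separable_over x) /\
  (forall p : {poly Om}, separable_poly p -> (1 < size p)%N -> exists x, root p x).

Definition normal_over (K : divringClosed Om) :=
  forall p : {poly subfield_type E}, irreducible_poly p ->
    (exists2 x, x \in K & root (lift_poly p) x) ->
    exists2 r : seq Om, {subset r <= K} & lift_poly p %= \prod_(x <- r) ('X - x%:P).

Definition galois_extension (K : divringClosed Om) :=
  [/\ {subset E <= K}, forall x, x \in K -> separable_over x & normal_over K].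

Definition two_extension (K : divringClosed Om) :=
  galois_extension K /\ pro2 (gal K E).

(* The maximal 2-extension of E in Om, as the compositum of all the Galois
   extensions of E in Om with pro-2 group: the intersection of the subfields N
   containing them. *)
Definition max_2ext : {pred Om} := fun x => `[< forall N : divringClosed Om,
  (forall K : divringClosed Om, two_extension K -> {subset K <= N}) -> x \in N >].

Lemma max_2ext_divring_closed : divring_closed max_2ext.
Proof.
split=> [|x y /asboolP xE /asboolP yE|x y /asboolP xE /asboolP yE].
- by apply/asboolP => N _; exact: rpred1.
- by apply/asboolP => N KN; rewrite rpredB ?xE ?yE.
- by apply/asboolP => N KN; rewrite rpred_div ?xE ?yE.
Qed.

HB.instance Definition _ := GRing.isDivringClosed.Build Om max_2ext
  max_2ext_divring_closed.

End Maximal2Extension.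

(* The class consists of realizable pairs because free products and cyclotomic
   semidirect products preserve realizability. *)
Inductive elementary_type : cyclotomic_pair -> Prop :=
| elementary_free (Om : fieldType) (E : divringClosed Om) of
    2%N \notin [pchar Om] & separable_closure E &
    free_pro2 (gal (max_2ext E) E) & topologically_fg (gal (max_2ext E) E) :
    elementary_type (galois_pair (max_2ext E) E)
| elementary_demushkin (Om : fieldType) (E : divringClosed Om) of
    2%N \notin [pchar Om] & separable_closure E & demushkin (gal (max_2ext E) E) :
    elementary_type (galois_pair (max_2ext E) E)
| elementary_free_product (P1 P2 P : cyclotomic_pair) of
    elementary_type P1 & elementary_type P2 & is_free_product P1 P2 P :
    elementary_type P
| elementary_semidirect (m : nat) (P : cyclotomic_pair) of
    (0 < m)%N & elementary_type P : elementary_type (sdprod_pair m P)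
| elementary_isomorphic (P Q : cyclotomic_pair) of
    elementary_type P & pair_isomorphic P Q : elementary_type Q.

Section Kaplansky.
Variable E : fieldType.

Definition D_form (a : E) : set E :=
  [set c | c != 0 /\ exists x y, c = x ^+ 2 + a * y ^+ 2].

Definition kaplansky_radical : set E := \bigcap_(a in [set a | a != 0]) D_form a.

Definition nonzero_squares : set E := [set x ^+ 2 | x in [set x | x != 0]].

End Kaplansky.

Arguments kaplansky_radical E : clear implicits.
Arguments nonzero_squares E : clear implicits.

(* Main.v *)
From HB Require Import structures.
Require Import Defs.
From mathcomp Require Import all_boot all_order all_algebra.
From mathcomp Require Import separable.
From mathcomp Require Import fingroup morphism quotient cyclic pgroup gseries maximal.
From mathcomp Require Import all_classical topology.

Set Implicit Arguments.
Unset Strict Implicit.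
Unset Printing Implicit Defensive.

Import GRing.Theory.

(** The class of elementary type pairs is built from groups by free products and
    semidirect products, whereas the Kaplansky radical is a notion about fields. The
    link between the two is the cup product on [H^1]: by Kummer theory the classes in
    [H^1] of the Galois group of the maximal 2-extension of [H] are the square
    classes of [H], and if [a] is represented by [<1, -b>], then the cup product of
    the classes of [a] and [b] vanishes. Hence an element of the Kaplansky radical
    gives a class in the radical of the cup product, and [R(H)] is reduced to the
    squares as soon as this radical is trivial ([kaplansky_radical_squares]).

    It remains to write every pro-2 group of elementary type as a free pro-2 product
    of a free pro-2 group and of a group whose cup product has trivial radical
    ([elementary_type_decomposition]). Free and Demushkin groups have this form with
    one trivial factor. For a free product, regroup the factors
    ([coproduct_regroup]): a coproduct of free groups is free, and a class in the
    radical of a coproduct restricts to the radicals of the factors. For a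
    semidirect product of [Z_2 ^ m] with [G], commutation relations show that the
    radical is trivial ([cup_radical_trivial_sd]), with one exception: if [m = 1] and
    [G] has no nonzero class, then [G] is trivial because it is pro-2, and the product
    is the free group [Z_2]. All factors are obtained as retracts, that is, as images of
    idempotent endomorphisms.

    On the field side, put [K = F(2)]. Automorphisms of [K] extend to the separable
    closure ([pemb_extend]), and [K] turns out to consist of the elements on which
    every automorphism over [F] acts with orbits of 2-power length ([mem_max_2ext]);
    hence [Gal(K / F)] is pro-2 and [K] is quadratically closed. The factors of
    [Gal(K / F)] correspond to intermediate fields by a form of Artin's lemma
    ([fixed_field_density]), which also yields the surjectivity of the Kummer map.
    The characters match because the canonical character is determined by the action
    on the roots of unity of 2-power order, all of which lie in [K]. *)

(** * Finite quotients *)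

Section Congruence.
Local Open Scope group_scope.
Variables (G : groupType) (N : set G).
Implicit Types x y z : G.

Lemma lcongr_sym x y : subgroup N -> N (x^-1 * y) -> N (y^-1 * x).
Proof. by case=> _ _ V /V; rewrite invgM invgK. Qed.

Lemma lcongr_trans y x z : subgroup N -> N (x^-1 * y) -> N (y^-1 * z) -> N (x^-1 * z).
Proof. by case=> _ M _ xy yz; have := M _ _ xy yz; rewrite -mulgA mulKVg. Qed.

Lemma lcongrM x y x' y' : normal_subgroup N ->
  N (x^-1 * y) -> N (x'^-1 * y') -> N ((x * x')^-1 * (y * y')).
Proof.
case=> -[_ M _] J xy xy'; have := M _ _ (J _ x' xy) xy'.
by rewrite !invgM -!mulgA mulKVg.
Qed.

End Congruence.

Section FiniteQuotient.
Variables (G : groupType) (N : set G).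
Hypothesis nN : normal_subgroup N.
Local Open Scope group_scope.

(** Turning the quotient into a finite group gives access to the theorems of Lagrange
    and Cauchy and to the maximal subgroups of 2-groups. *)
Lemma finite_quotient d : has_index N d ->
  exists (Q : finGroupType) (c : G -> Q),
    [/\ #|Q| = d, {morph c : x y / x * y}, forall q, exists x, c x = q &
        forall x y, c x = c y <-> N (x^-1 * y)].
Proof.
have sN := nN.1; case=> t tP.
have [c cP] := choice tP.
have cN x : N ((t (c x))^-1 * x) by case: (cP x).
have cI x i : N ((t i)^-1 * x) -> c x = i by case: (cP x) => _; apply.
have cE x y : c x = c y <-> N (x^-1 * y).
  split=> [xy|xy]; last exact/esym/cI/(lcongr_trans sN (cN x)).
  by apply: (lcongr_trans (y := t (c x)) sN); [exact: lcongr_sym|rewrite xy].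
have ct i : c (t i) = i by apply: cI; rewrite mulVg; case: sN.
pose op i j := c (t i * t j); pose ivt i := c (t i)^-1; pose e := c 1.
have cM x y : c (x * y) = op (c x) (c y).
  by apply/cE/(lcongrM nN); apply: lcongr_sym.
have opA : associative op.
  by move=> i j k; rewrite -[i]ct -[j]ct -[k]ct -!cM mulgA.
have op1 : left_id e op by move=> i; rewrite -[i]ct -cM mul1g.
have opV : left_inverse e ivt op.
  by move=> i; rewrite -[X in op _ X]ct /ivt -cM mulVg.
pose Q : finGroupType := HB.pack 'I_d (Finite_isGroup.Build 'I_d opA op1 opV).
exists Q, c; split=> //; first by rewrite card_ord.
by move=> q; exists (t q).
Qed.

Lemma index_pow_mem k x : has_index N (2 ^ k) -> N (x ^+ (2 ^ k)).
Proof.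
move=> /finite_quotient [Q [c [cQ cM _ cE]]].
have c1 : c 1 = 1.
  by apply: (@mulgI _ (c 1)); rewrite -cM !mulg1.
have cX n : c (x ^+ n) = c x ^+ n.
  by elim: n => [|n IH]; rewrite ?expg0 // !expgS cM IH.
have /cE : c 1 = c (x ^+ (2 ^ k)).
  apply/esym/eqP; rewrite c1 cX -order_dvdn -cQ -cardsT; apply: order_dvdG.
  by rewrite inE.
by rewrite invg1 mul1g.
Qed.

Lemma index_pow2 d : has_index N d -> (forall x, exists k, N (x ^+ (2 ^ k))) ->
  exists k, d = (2 ^ k)%N.
Proof.
move=> /finite_quotient [Q [c [cQ cM cS cE]]] NX.
have c1 : c 1 = 1.
  by apply: (@mulgI _ (c 1)); rewrite -cM !mulg1.
have cX x n : c (x ^+ n) = c x ^+ n.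
  by elim: n => [|n IH]; rewrite ?expg0 // !expgS cM IH.
have : 2.-group [set: Q].
  apply/pgroupP => p pp /Cauchy [//|q _ oq].
  have [x xq] := cS q; have [k Nk] := NX x.
  have : q ^+ (2 ^ k) = 1.
    by rewrite -xq -cX -c1; apply/esym/cE; rewrite invg1 mul1g.
  move/eqP; by rewrite -order_dvdn oq Euclid_dvdX // dvdn_prime2 // => /andP[].
by rewrite -cQ -cardsT => /p_natP[k e]; exists k.
Qed.

(** The kernel is the preimage of a maximal subgroup of the quotient, whose index is
    2 because the quotient is a 2-group. *)
Lemma index_pow2_character k : has_index N (2 ^ k) -> N != classical_sets.setT ->
  exists chi : G -> bool, [/\ {morph chi : x y / x * y >-> x (+) y},
    forall x, N x -> chi x = false & exists x, chi x].
Proof.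
move=> /finite_quotient [Q [c [cQ cM cS cE]]] NT.
have c1 : c 1 = 1.
  by apply: (@mulgI _ (c 1)); rewrite -cM !mulg1.
have [|[M maxM _]] := @maximal_exists _ [1 Q]%G [set: Q]%G (sub1G _).
  move=> Q1; case/negP: NT; apply/eqP/seteqP; split=> // x _.
  have := @cE 1 x; rewrite invg1 mul1g => -[+ _]; apply.
  have /set1gP -> : c 1 \in [1 Q] by rewrite Q1 inE.
  by apply/esym/set1gP; rewrite Q1 inE.
have pQ : 2.-group [set: Q] by rewrite /pgroup (_ : #|_| = 2 ^ k)%N ?pnatX // -cQ -cardsT.
have iM := p_maximal_index pQ maxM.
have nM := p_maximal_normal pQ maxM.
have Mn x : x \in 'N(M)%g by move/normal_norm/fintype.subsetP: nM; apply; rewrite inE.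
have cM1 x : (coset M x == 1) = (x \in M).
  apply/eqP/idP => [|/coset_id //]; exact: coset_idr.
have card2 : #|[set: Q] / M| = 2 by rewrite card_quotient ?normal_norm.
have eq1 (a b : coset_of M) : a != 1 -> b != 1 -> a \in [set: Q] / M -> b \in [set: Q] / M ->
    a = b.
  move=> a1 b1 aQ bQ; apply/eqP; apply: contraT => ab.
  suff : (#|[set 1%g; a; b]%SET| <= #|[set: Q] / M|)%N.
    rewrite card2 -finset.setUA cardsU1 !inE negb_or eq_sym a1 eq_sym b1 /=.
    by rewrite cards2 ab.
  by apply/subset_leq_card/fintype.subsetP => z; rewrite !inE => /orP[/orP[]|] /eqP ->.
have inQ q : coset M q \in [set: Q] / M by apply: mem_quotient; rewrite inE.
exists (fun x => c x \notin M); split.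
- move=> x y; rewrite cM.
  have [xM|xM] := boolP (c x \in M); first by rewrite groupMl.
  have [yM|yM] := boolP (c y \in M); first by rewrite groupMr ?xM.
  rewrite -cM1 (morphM (coset_morphism M)) //=.
  rewrite (eq1 (coset M (c y)) (coset M (c x))^-1) ?mulgV ?eqxx //.
  + by rewrite cM1.
  + by rewrite invg_eq1 cM1.
  + by rewrite groupV.
- move=> x Nx; apply/negbTE; rewrite negbK; suff -> : c x = 1 by exact: group1.
  by rewrite -c1; apply/esym/cE; rewrite invg1 mul1g.
have /properP[_ [q _ qM]] := maxgroupp maxM.
by have [x xq] := cS q; exists x; rewrite xq.
Qed.
End FiniteQuotient.

Local Open Scope classical_set_scope.
Local Open Scope ring_scope.

(** * Topological groups *)

Section GroupMorphism.
Variables (G H : groupType) (f : G -> H).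
Hypothesis fM : {morph f : x y / (x * y)%g}.

Lemma hom1 : f 1%g = 1%g.
Proof. by apply: (@mulgI _ (f 1%g)); rewrite -fM !mulg1. Qed.

Lemma homV x : f x^-1%g = (f x)^-1%g.
Proof. by apply: (@mulgI _ (f x)); rewrite -fM !mulgV hom1. Qed.

Lemma normal_subgroup_preimage (N : set H) :
  normal_subgroup N -> normal_subgroup (f @^-1` N).
Proof.
case=> -[N1 NM NV] NJ; split=> [|x y /= Nx]; last by rewrite !fM homV; exact: NJ.
split=> [|x y /= Nx Ny|x /= Nx]; first by rewrite /= hom1.
  by rewrite fM; exact: NM.
by rewrite homV; exact: NV.
Qed.
End GroupMorphism.

Lemma continuous_hom_comp (G H T : topGroupType) (f : G -> H) (g : H -> T) :
  continuous_hom f -> continuous_hom g -> continuous_hom (g \o f).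
Proof.
move=> [fc fM] [gc gM]; split=> [x|x y /=]; last by rewrite fM gM.
exact: continuous_comp (fc x) (gc _).
Qed.

Lemma continuous_hom_id (G : topGroupType) : continuous_hom (@id G).
Proof. by split=> // x; exact: cvg_id. Qed.

Lemma continuous_hom_cst (G H : topGroupType) : continuous_hom (fun _ : G => 1%g : H).
Proof. by split=> [x|x y]; [exact: cst_continuous|rewrite mulg1]. Qed.

Lemma continuous_pair (T U V : topologicalType) (f : T -> U) (g : T -> V) x :
  {for x, continuous f} -> {for x, continuous g} ->
  {for x, continuous (fun y => (f y, g y))}.
Proof. by move=> fc gc; exact: cvg_pair. Qed.

Lemma continuousMg (T : topologicalType) (G : topGroupType) (f g : T -> G) x :
  {for x, continuous f} -> {for x, continuous g} ->
  {for x, continuous (fun y => (f y * g y)%g)}.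
Proof.
move=> fc gc.
apply: (@continuous_comp _ _ _ (fun y => (f y, g y)) (fun xy => (xy.1 * xy.2)%g)).
  exact: cvg_pair.
exact: mulg_continuous.
Qed.

Lemma mulg_continuousl (G : topGroupType) (a : G) : continuous (fun x : G => (a * x)%g).
Proof.
by move=> x; apply: continuousMg; [exact: cst_continuous|exact: cvg_id].
Qed.

(** A translate of a neighbourhood of 1 contained in the subgroup is a
    neighbourhood of any given element. *)
Lemma nbhs_subgroup_open (G : topGroupType) (N : set G) :
  subgroup N -> nbhs 1%g N -> open N.
Proof.
move=> [N1 NM NV] NN; rewrite openE => x Nx /=.
have : nbhs ((x^-1 * x)%g) N by rewrite mulVg.
move=> /(mulg_continuousl (a := x^-1%g)); rewrite nbhs_simpl /=.
apply: filterS => y /= /(NM _ _ Nx); by rewrite mulKVg.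
Qed.

Lemma open_lcoset (G : topGroupType) (N : set G) x :
  open N -> open [set y | N (x^-1 * y)%g].
Proof.
move=> oN; apply: (@open_comp _ _ (fun y => (x^-1 * y)%g)) => // y _.
exact: mulg_continuousl.
Qed.

(** The cosets of an open subgroup form an open cover, of which finitely many
    members suffice. *)
Lemma compact_open_index (G : topGroupType) (N : set G) :
  compact [set: G] -> open N -> subgroup N -> exists d, has_index N d.
Proof.
move=> cG oN sN; have [N1 _ _] := sN.
pose r x := xget 1%g [set y : G | N (x^-1 * y)%g].
have rN x : N (x^-1 * r x)%g.
  by rewrite /r; case: xgetP => // /(_ x); rewrite /= mulVg.
have rE x y : N (x^-1 * y)%g -> r x = r y.
  move=> xy; rewrite /r; congr xget; apply/seteqP; split=> z /=.
    exact/(lcongr_trans sN)/(lcongr_sym sN).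
  exact: lcongr_trans.
have finr : finite_set (range r).
  pose F := filter_from [set: seq G] (fun s => [set s' : seq G | {subset s <= s'}]).
  have FF : Filter F.
    apply: filter_from_filter; first by exists [::].
    move=> s s' _ _; exists (s ++ s') => // u su.
    by split=> z zs; apply: su; rewrite mem_cat zs ?orbT.
  have [x _|s _ sG] := (compact_near_coveringP _).1 cG _ F
      (fun s x => exists2 y, y \in s & N (x^-1 * y)%g) FF.
    exists ([set y | N (x^-1 * y)%g], [set s | {subset [:: x] <= s}]).
      split; last by exists [:: x].
      by apply: open_nbhs_nbhs; split; [exact: open_lcoset|rewrite /= mulVg].
    case=> y s [/= xy xs]; exists x; last exact: lcongr_sym.
    by apply: xs; rewrite inE.
  apply: (@sub_finite_set _ _ (r @` [set` s])) => [_ [x _ <-]|].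
    by have [y ys xy] := sG s (fun z zs => zs) x Logic.I; exists y => //; exact/esym/rE.
  exact/finite_image/finite_seq.
have [s sE] := (finite_seqP _).1 finr.
pose u := undup s.
have us x : r x \in u by rewrite mem_undup; have : [set` s] (r x) by rewrite -sE; exists x.
have ur y : y \in u -> r y = y.
  rewrite mem_undup => ys; have : [set` s] y by [].
  rewrite -sE => -[x _ <-]; apply/esym/rE/rN.
exists (size u), (fun i => tnth (in_tuple u) i) => x.
have iu : (index (r x) u < size u)%N by rewrite index_mem.
exists (Ordinal iu); split=> [|j xj].
  by rewrite (tnth_nth x) /= nth_index //; exact: lcongr_sym.
apply: val_inj => /=; rewrite -(rE _ _ xj) ur ?mem_tnth //.
by rewrite (tnth_nth x) /= index_uniq // undup_uniq.
Qed.

(** * Open normal subgroups of pro-2 groups *)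

(** In a compact Hausdorff space, the intersection of the clopen sets containing
    a point is connected, since disjoint open neighbourhoods of two closed pieces
    cut some clopen set in two. *)
Lemma compact_totally_disconnected_zero_dimensional (T : topologicalType) :
  compact [set: T] -> hausdorff_space T -> totally_disconnected [set: T] ->
  zero_dimensional T.
Proof.
move=> cT hT tdT x y xy.
pose Q := [set z : T | forall C : set T, clopen C -> C x -> C z].
have Qx : Q x by [].
have [Qy|] := pselect (Q y); last first.
  move=> /existsNP[C /not_implyP[clC /not_implyP[Cx Cy]]]; by exists C.
have cQ : closed Q.
  rewrite (_ : Q = \bigcap_(C in [set C : set T | clopen C /\ C x]) C).
    by apply: closed_bigI => C [[]].
  apply/seteqP; split=> z Qz; first by move=> C [? ?]; exact: Qz.
  by move=> C ? ?; apply: Qz.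
(* By compactness of the complement of [W], a clopen set already fits into [W]. *)
have QC (W : set T) : open W -> Q `<=` W ->
    exists C, [/\ clopen C, C x & C `<=` W].
  move=> oW QW.
  have cW : compact (~` W) by apply: (subclosed_compact (open_closedC oW) cT).
  pose F := filter_from [set C : set T | clopen C /\ C x]
    (fun C => [set D | D `<=` C /\ clopen D /\ D x]).
  have FF : Filter F.
    apply: filter_from_filter; first by exists setT; split=> //; exact: clopenT.
    move=> A B [cA Ax] [cB Bx]; exists (A `&` B); first by split=> //; exact: clopenI.
    by move=> D [DAB ?]; split; split=> // z /DAB [].
  have := (compact_near_coveringP _).1 cW _ F (fun D z => ~ D z) FF.
  case=> [z nWz|C [cC Cx] CW].
    have /existsNP[C /not_implyP[clC /not_implyP[Cx Cz]]] : ~ Q z by move=> /QW.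
    exists (~` C, [set D | D `<=` C /\ clopen D /\ D x]).
      split; last by exists C.
      by apply: open_nbhs_nbhs; split=> //; apply: closed_openC; case: clC.
    by case=> a D [/= Ca [DC _]] /DC.
  exists C; split=> // z Cz; apply: contrapT => nWz.
  by have := CW C (conj (@subset_refl _ C) (conj cC Cx)) z nWz; apply.
suff conQ : connected Q.
  have := connected_component_max Qx (fun _ _ => Logic.I) conQ Qy.
  by rewrite tdT //= => yx; rewrite yx eqxx in xy.
move=> B [b Bb] [U oU BU] [D cD BD].
have cB : closed B by rewrite BD; exact: closedI.
have cA : closed (Q `&` ~` U) by apply: closedI => //; exact: open_closedC.
have AB : B `<=` ~` (Q `&` ~` U) by move=> z + [_ nUz]; rewrite BU => -[].
have [W0 BW0 W0A] : filter_from (set_nbhs B) closure (~` (Q `&` ~` U)).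
  apply: (compact_normal hT cT cB); apply/set_nbhsP.
  by exists (~` (Q `&` ~` U)); split=> //; exact: closed_openC.
have [W [oW BW WW0]] := (set_nbhsP _ _).1 BW0.
have WA z : closure W z -> Q z -> U z.
  move=> Wz Qz; apply: contrapT => Uz; apply: (W0A z) => //.
  exact: closureS Wz.
have [|z Qz|C [[oC cC] Cx CW]] := QC (W `|` ~` closure W).
- by apply: openU => //; apply: closed_openC; exact: closed_closure.
- have [Uz|nUz] := pselect (U z); first by left; apply: BW; rewrite BU.
  by right => /WA /(_ Qz).
have [Wx|nWx] := pselect (closure W x).
  have clCW : clopen (C `&` W).
    split; first exact: openI.
    rewrite (_ : C `&` W = C `&` closure W).
      by apply: closedI => //; exact: closed_closure.
    apply/seteqP; split=> z [Cz Wz]; split=> //; first exact: subset_closure.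
    by case: (CW z Cz).
  have CWx : (C `&` W) x by split=> //; case: (CW x Cx).
  apply/seteqP; split=> z; rewrite BU; first by case.
  move=> Qz; split=> //.
  by have [_ /subset_closure Wz] := Qz _ clCW CWx; exact: WA.
have clCW : clopen (C `&` ~` W).
  split; last by apply: closedI => //; exact: open_closedC.
  rewrite (_ : C `&` ~` W = C `&` ~` closure W).
    by apply: openI => //; apply: closed_openC; exact: closed_closure.
  apply/seteqP; split=> z [Cz Wz]; split=> //; last by move=> /subset_closure.
  by case: (CW z Cz).
have CWx : (C `&` ~` W) x by split=> // /subset_closure.
have Qb : Q b by move: Bb; rewrite BU => -[].
by have [_ /(_ (BW _ Bb))] := Qb _ clCW CWx.
Qed.

(** The stabiliser of a clopen neighbourhood of 1 for right translation is an open
    subgroup contained in it; compactness also makes the intersection of its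
    conjugates open. *)
Lemma open_normal_basis (G : topGroupType) (U : set G) :
  pro2 G -> nbhs 1%g U ->
  exists N : set G, [/\ open N, normal_subgroup N, N `<=` U & exists k, has_index N (2 ^ k)%N].
Proof.
move=> [cG hG tG iG] U1.
have zG := compact_totally_disconnected_zero_dimensional cG hG tG.
have [V [V1 [oV cV]] VU] := zero_dimensional_cvg hG zG cG U1.
pose N := [set g : G | forall x v, V v ->
  V (v * (x^-1 * g * x))%g /\ V (v * (x^-1 * g^-1 * x))%g].
have NN : normal_subgroup N.
  split; first split=> [x v Vv|g h Ng Nh x v Vv|g Ng x v Vv].
  - by rewrite invg1 mulg1 mulVg mulg1.
  - have [V1' _] := Ng x v Vv; have [V2' _] := Nh x _ V1'.
    have [_ V3'] := Nh x v Vv; have [_ V4'] := Ng x _ V3'.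
    split; first by move: V2'; rewrite !mulgA mulgK.
    by move: V4'; rewrite invgM !mulgA mulgK.
  - by rewrite invgK; have [] := Ng x v Vv.
  - move=> g y Ng x v Vv.
    by have := Ng (y * x)%g v Vv; rewrite !invgM !invgK !mulgA.
have oN : open N.
  apply: nbhs_subgroup_open; first by case: NN.
  have cVV : compact (setT `*` V : set (G * G)).
    by apply: compact_setX => //; apply: (subclosed_compact cV cG).
  pose phi (p : G * (G * G)) := (p.2.2 * (p.2.1^-1 * p.1 * p.2.1))%g.
  have phic : continuous phi.
    move=> p.
    have c1 : {for p, continuous (fun q : G * (G * G) => q.1)} by exact: cvg_fst.
    have c2 : {for p, continuous (fun q : G * (G * G) => q.2)} by exact: cvg_snd.
    have c21 : {for p, continuous (fun q : G * (G * G) => q.2.1)}.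
      by apply: (continuous_comp c2); exact: cvg_fst.
    have c22 : {for p, continuous (fun q : G * (G * G) => q.2.2)}.
      by apply: (continuous_comp c2); exact: cvg_snd.
    apply: (continuousMg c22); apply: (continuousMg _ c21); apply: (continuousMg _ c1).
    by apply: (continuous_comp c21); exact: invg_continuous.
  have nearV (g0 : G) (h : G -> G) : h 1%g = 1%g -> {for 1%g, continuous h} ->
    \forall g \near 1%g, setT `*` V `<=` (fun xv => V (phi (h g, xv))).
    move=> h1 hc; apply: (compact_near_coveringP _).1 => // -[x v] [_ /= Vv].
    have c : {for ((x, v), 1%g : G), continuous (fun q : (G * G) * G => phi (h q.2, q.1))}.
      apply: (@continuous_comp _ _ _ (fun q : (G * G) * G => (h q.2, q.1)) phi).
        apply: continuous_pair; last exact: cvg_fst.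
        apply: (@continuous_comp _ _ _ (fun q : (G * G) * G => q.2) h) => //.
        exact: cvg_snd.
      exact: phic.
    apply: (c V); apply: open_nbhs_nbhs; split=> //.
    by rewrite /phi /= h1 mulg1 mulVg mulg1.
  have := nearV 1%g id erefl (@cvg_id _ _).
  have := nearV 1%g _ (invg1 _) (@invg_continuous G _).
  apply: filterS2 => g gV gV' x v Vv; split; first exact: (gV' (x, v) (conj Logic.I Vv)).
  exact: (gV (x, v) (conj Logic.I Vv)).
exists N; split=> //; last exact: iG.
by move=> g /(_ 1%g 1%g V1) []; rewrite invg1 !mul1g mulg1 => /VU.
Qed.

(** Compactness and the indices pass to the image of [r], separation and total
    disconnectedness to the domain of the injective map [i]. *)
Lemma pro2_retract (G A : topGroupType) (i : A -> G) (r : G -> A) :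
  pro2 G -> continuous_hom i -> continuous_hom r -> cancel i r -> pro2 A.
Proof.
move=> [cG hG tG iG] [ic iM] [rc rM] ir; split.
- have -> : [set: A] = r @` [set: G].
    by apply/esym/seteqP; split=> // a _; exists (i a).
  by apply: continuous_compact => //; exact: continuous_subspaceT.
- move=> x y xy; apply: (can_inj ir); apply: hG => U V xU yV.
  by have [z [? ?]] := xy _ _ (ic _ _ xU) (ic _ _ yV); exists (i z).
- move=> x _; apply/seteqP; split=> [y [C [Cx _ cC] Cy]|y ->]; last first.
    by apply: connected_component_refl.
  have ciC : connected (i @` C).
    by apply: connected_continuous_connected => //; exact: continuous_subspaceT.
  have : connected_component [set: G] (i x) (i y).
    by exists (i @` C); [split=> //; exists x|exists y].
  by rewrite tG //= => /(can_inj ir).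
- move=> N oN nN.
  have [||k [t tP]] := iG (r @^-1` N).
  + by apply: open_comp => // x _; exact: rc.
  + exact: normal_subgroup_preimage.
  exists k, (fun j => r (t j)) => x; have := tP (i x).
  rewrite /= (_ : (fun j => N _) = (fun j => N ((r (t j))^-1 * x)%g)) //.
  by apply/funext => j; rewrite rM ir homV.
Qed.

(** * The trivial group and the group of order two *)

Definition trivial_group := unit.
HB.instance Definition _ := Choice.on trivial_group.
HB.instance Definition _ := Topological.copy trivial_group (discrete_topology unit).

Definition tg_mul (x y : trivial_group) : trivial_group := tt.
Fact tg_mulA : associative tg_mul. Proof. by []. Qed.
Fact tg_mul1 : left_id tt tg_mul. Proof. by case. Qed.
Fact tg_1mul : right_id tt tg_mul. Proof. by case. Qed.
Fact tg_mulV : left_inverse tt (fun _ => tt) tg_mul. Proof. by []. Qed.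
Fact tg_Vmul : right_inverse tt (fun _ => tt) tg_mul. Proof. by []. Qed.
HB.instance Definition _ :=
  isGroup.Build trivial_group tg_mulA tg_mul1 tg_1mul tg_mulV tg_Vmul.
Fact tg_mul_continuous :
  continuous (fun xy : trivial_group * trivial_group => (xy.1 * xy.2)%g).
Proof. exact: cst_continuous. Qed.
Fact tg_inv_continuous : continuous (fun x : trivial_group => x^-1%g).
Proof. exact: cst_continuous. Qed.
HB.instance Definition _ :=
  isTopologicalGroup.Build trivial_group tg_mul_continuous tg_inv_continuous.

(** As a pro-2 group in its own right, so that the universal properties of pro-2
    groups apply to the elements of [H^1], its continuous characters. *)
Definition C2 := 'F_2.
HB.instance Definition _ := Choice.on C2.
HB.instance Definition _ := Topological.copy C2 (discrete_topology 'F_2).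
HB.instance Definition _ := isGroup.Build C2
  (@addrA 'F_2) (@add0r 'F_2) (@addr0 'F_2) (@addNr 'F_2) (@addrN 'F_2).

Lemma C2_nbhs1 (x : C2) : nbhs x [set x].
Proof. exact: (@discrete_set1 (discrete_topology 'F_2)). Qed.

Lemma C2_continuous (T : topologicalType) (f : C2 -> T) : continuous f.
Proof.
move=> x A xA; have := @C2_nbhs1 x; rewrite /= nbhs_simpl.
by apply: (@filterS _ _ (@nbhs_filter C2 x)) => _ ->; exact: nbhs_singleton xA.
Qed.

Fact C2_mul_continuous : continuous (fun xy : C2 * C2 => (xy.1 * xy.2)%g).
Proof.
case=> x y A xyA; exists ([set x], [set y]); first by split; exact: C2_nbhs1.
by case=> _ _ [/= -> ->]; exact: nbhs_singleton xyA.
Qed.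
Fact C2_inv_continuous : continuous (fun x : C2 => x^-1%g).
Proof. exact: C2_continuous. Qed.
HB.instance Definition _ :=
  isTopologicalGroup.Build C2 C2_mul_continuous C2_inv_continuous.

Lemma C2_pro2 : pro2 C2.
Proof.
have cC : compact [set: C2].
  by apply: finite_compact; exact: (@finite_finset 'F_2).
split=> //.
- by move=> x y /(_ _ _ (@C2_nbhs1 x) (@C2_nbhs1 y)) [z [-> ->]].
- apply: zero_dimension_totally_disconnected.
  exact: (@discrete_zero_dimension (discrete_topology 'F_2)).
- move=> N oN nN; have [sN _] := nN.
  have [d Nd] := compact_open_index cC oN sN.
  have [|k dk] := index_pow2 nN Nd; last by exists k; rewrite -dk.
  move=> x; exists 1%N; suff /= -> : (x ^+ (2 ^ 1)%N)%g = 1%g by case: sN.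
  by case: x => -[|[|[]]] // i; apply: val_inj.
Qed.

Lemma trivial_group_pro2 : pro2 trivial_group.
Proof.
have H : continuous_hom (fun _ : C2 => tt : trivial_group).
  by split=> // x; exact: cst_continuous.
by apply: (pro2_retract C2_pro2 (continuous_hom_cst trivial_group C2) H) => -[].
Qed.

Lemma H1_C2 (G : topGroupType) (chi : G -> 'F_2) :
  H1 chi <-> continuous_hom (chi : G -> C2).
Proof. by split=> -[? ?]; split. Qed.

(** Some open normal subgroup misses [g], and the quotient by it is a nontrivial
    2-group. *)
Lemma pro2_nontrivial_H1 (G : topGroupType) (g : G) : pro2 G -> g != 1%g ->
  exists chi, H1 chi /\ exists x : G, chi x <> 0.
Proof.
move=> pG g1; have [cG hG tG iG] := pG.
have [U [U1 Ug]] : exists U : set G, nbhs 1%g U /\ ~ U g.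
  apply: contrapT => nU; case/eqP: g1; apply: hG => A B Ag B1.
  exists g; split; first exact: nbhs_singleton.
  by apply: contrapT => nBg; apply: nU; exists B.
have [N [oN nN NU [k Nk]]] := open_normal_basis pG U1.
have [|chi [chiM chiN [x chix]]] := index_pow2_character nN Nk.
  by apply/eqP => NT; apply/Ug/NU; rewrite NT.
exists (fun x => (chi x)%:R); split; last by exists x; rewrite chix.
split=> [y A Ay|y z]; last by rewrite chiM; case: (chi y); case: (chi z); apply: val_inj.
have : nbhs y [set z | N (y^-1 * z)%g].
  by apply: open_nbhs_nbhs; split; [exact: open_lcoset|rewrite /= mulVg; case: nN => -[]].
rewrite /= nbhs_simpl /=; apply: filterS => z /chiN.
rewrite chiM => yz; suff zy : chi z = chi y by rewrite /= zy; exact: nbhs_singleton Ay.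
have : chi 1%g = false by apply: chiN; case: nN => -[].
by rewrite -(mulVg y) chiM; move: yz; case: (chi y); case: (chi z); case: (chi _).
Qed.

(** * Free pro-2 products *)

Definition pro2_coproduct (A B G : topGroupType) (i : A -> G) (j : B -> G) :=
  forall (T : topGroupType) (f1 : A -> T) (f2 : B -> T), pro2 T ->
    continuous_hom f1 -> continuous_hom f2 ->
    exists! f : G -> T, [/\ continuous_hom f, f \o i = f1 & f \o j = f2].

Section Coproduct.
Variables (A B G : topGroupType) (i : A -> G) (j : B -> G).
Hypotheses (hi : continuous_hom i) (hj : continuous_hom j).

Lemma coproduct_ext (T : topGroupType) (f f' : G -> T) :
  pro2_coproduct i j -> pro2 T -> continuous_hom f -> continuous_hom f' ->
  f \o i =1 f' \o i -> f \o j =1 f' \o j -> f =1 f'.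
Proof.
move=> univ pT hf hf' /funext fi /funext fj x.
have [g [_ gU]] := univ T _ _ pT (continuous_hom_comp hi hf) (continuous_hom_comp hj hf).
have <- : g = f by apply: gU.
by have <- : g = f' by apply: gU.
Qed.

Lemma coproduct_exists (T : topGroupType) (f1 : A -> T) (f2 : B -> T) :
  pro2_coproduct i j -> pro2 T -> continuous_hom f1 -> continuous_hom f2 ->
  exists f : G -> T, [/\ continuous_hom f, f \o i =1 f1 & f \o j =1 f2].
Proof.
by move=> univ pT h1 h2; have [f [[hf <- <-] _]] := univ T _ _ pT h1 h2; exists f.
Qed.

Lemma pro2_coproductI :
  (forall (T : topGroupType) (f f' : G -> T), pro2 T ->
     continuous_hom f -> continuous_hom f' ->
     f \o i =1 f' \o i -> f \o j =1 f' \o j -> f =1 f') ->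
  (forall (T : topGroupType) (f1 : A -> T) (f2 : B -> T), pro2 T ->
     continuous_hom f1 -> continuous_hom f2 ->
     exists f : G -> T, [/\ continuous_hom f, f \o i =1 f1 & f \o j =1 f2]) ->
  pro2_coproduct i j.
Proof.
move=> ext ex T f1 f2 pT h1 h2; have [f [hf fi fj]] := ex T f1 f2 pT h1 h2.
exists f; split; first by split=> //; exact/funext.
move=> g [hg gi gj]; apply/funext; apply: ext => // x.
  by rewrite fi -gi.
by rewrite fj -gj.
Qed.
End Coproduct.

Record idempotent (G : topGroupType) := Idempotent {
  idem_fun :> G -> G;
  idem_hom : continuous_hom idem_fun;
  idemK : forall x, idem_fun (idem_fun x) = idem_fun x
}.

Section IdempotentImage.
Variables (G : topGroupType) (e : idempotent G).

(** The image of an idempotent, encoded as its set of fixed points. Being a retract,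
    it inherits from [G] all that is needed of a closed subgroup. *)
Definition idem_image : Type := set_type [set x | e x = x].
HB.instance Definition _ := Topological.copy idem_image (set_type [set x | e x = x]).

Definition idem_val (x : idem_image) : G := val x.
Definition idem_proj (x : G) : idem_image := SigSub (mem_set (idemK e x)).

Lemma idem_valP x : e (idem_val x) = idem_val x.
Proof. exact: (set_mem (valP x)). Qed.

Lemma idem_valK : cancel idem_val idem_proj.
Proof. by move=> x; apply: val_inj; exact: idem_valP. Qed.

Lemma idem_projK x : idem_val (idem_proj x) = e x. Proof. by []. Qed.

Lemma idem_val_continuous : continuous idem_val.
Proof. exact: initial_continuous. Qed.

Lemma idem_val_reflects (T : topologicalType) (f : T -> idem_image) :
  continuous (idem_val \o f) -> continuous f.
Proof. exact: continuous_comp_initial. Qed.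

Definition idem_mul (x y : idem_image) : idem_image := idem_proj (idem_val x * idem_val y)%g.
Definition idem_inv (x : idem_image) : idem_image := idem_proj (idem_val x)^-1%g.
Definition idem_one : idem_image := idem_proj 1%g.

Fact idem_val1 : idem_val idem_one = 1%g.
Proof. by rewrite idem_projK (hom1 (idem_hom e).2). Qed.
Fact idem_valM x y : idem_val (idem_mul x y) = (idem_val x * idem_val y)%g.
Proof. by rewrite idem_projK (idem_hom e).2 !idem_valP. Qed.
Fact idem_valV x : idem_val (idem_inv x) = (idem_val x)^-1%g.
Proof. by rewrite idem_projK (homV (idem_hom e).2) idem_valP. Qed.

Fact idem_mulA : associative idem_mul.
Proof. by move=> x y z; apply: (can_inj idem_valK); rewrite !idem_valM mulgA. Qed.
Fact idem_mul1 : left_id idem_one idem_mul.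
Proof. by move=> x; apply: (can_inj idem_valK); rewrite idem_valM idem_val1 mul1g. Qed.
Fact idem_1mul : right_id idem_one idem_mul.
Proof. by move=> x; apply: (can_inj idem_valK); rewrite idem_valM idem_val1 mulg1. Qed.
Fact idem_mulV : left_inverse idem_one idem_inv idem_mul.
Proof.
by move=> x; apply: (can_inj idem_valK); rewrite idem_valM idem_valV idem_val1 mulVg.
Qed.
Fact idem_Vmul : right_inverse idem_one idem_inv idem_mul.
Proof.
by move=> x; apply: (can_inj idem_valK); rewrite idem_valM idem_valV idem_val1 mulgV.
Qed.

HB.instance Definition _ :=
  isGroup.Build idem_image idem_mulA idem_mul1 idem_1mul idem_mulV idem_Vmul.

Fact idem_mul_continuous : continuous (fun xy : idem_image * idem_image => (xy.1 * xy.2)%g).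
Proof.
apply: idem_val_reflects => xy.
rewrite (_ : _ \o _ = fun xy => (idem_val xy.1 * idem_val xy.2)%g); last first.
  by apply/funext => z; exact: idem_valM.
have c1 : {for xy, continuous (fun z : idem_image * idem_image => z.1)} by exact: cvg_fst.
have c2 : {for xy, continuous (fun z : idem_image * idem_image => z.2)} by exact: cvg_snd.
apply: (continuousMg (f := idem_val \o fst) (g := idem_val \o snd)).
  by apply: (continuous_comp c1); exact: idem_val_continuous.
by apply: (continuous_comp c2); exact: idem_val_continuous.
Qed.

Fact idem_inv_continuous : continuous (fun x : idem_image => x^-1%g).
Proof.
apply: idem_val_reflects => x.
rewrite (_ : _ \o _ = fun x => (idem_val x)^-1%g); last first.
  by apply/funext => z; exact: idem_valV.
apply: (continuous_comp (@idem_val_continuous x)); exact: invg_continuous.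
Qed.

HB.instance Definition _ :=
  isTopologicalGroup.Build idem_image idem_mul_continuous idem_inv_continuous.

Lemma idem_val_hom : continuous_hom idem_val.
Proof. by split; [exact: idem_val_continuous|exact: idem_valM]. Qed.

Lemma idem_proj_hom : continuous_hom idem_proj.
Proof.
split; first by apply: idem_val_reflects; exact: (idem_hom e).1.
by move=> x y; apply: (can_inj idem_valK); rewrite [RHS]idem_valM !idem_projK (idem_hom e).2.
Qed.
End IdempotentImage.

Section Coproduct4.
Variables (F1 F2 B1 B2 G : topGroupType).
Variables (a1 : F1 -> G) (a2 : F2 -> G) (b1 : B1 -> G) (b2 : B2 -> G).

(** Uniqueness and existence of the maps out of [G] are stated separately: each is
    applied to maps that do not come from the other. *)
Definition pro2_coproduct4 :=
  (forall (T : topGroupType) (f f' : G -> T), pro2 T ->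
     continuous_hom f -> continuous_hom f' ->
     f \o a1 =1 f' \o a1 -> f \o a2 =1 f' \o a2 ->
     f \o b1 =1 f' \o b1 -> f \o b2 =1 f' \o b2 -> f =1 f') /\
  (forall (T : topGroupType) (f1 : F1 -> T) (f2 : F2 -> T) (g1 : B1 -> T) (g2 : B2 -> T),
     pro2 T -> continuous_hom f1 -> continuous_hom f2 ->
     continuous_hom g1 -> continuous_hom g2 ->
     exists2 f : G -> T, continuous_hom f &
       [/\ f \o a1 =1 f1, f \o a2 =1 f2, f \o b1 =1 g1 & f \o b2 =1 g2]).

(** Killing two of the four factors is an idempotent endomorphism, whose image is
    the coproduct of the other two. *)
Lemma coproduct4_half :
  continuous_hom a1 -> continuous_hom a2 -> continuous_hom b1 -> continuous_hom b2 ->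
  pro2 G -> pro2_coproduct4 ->
  exists (A : topGroupType) (i : A -> G) (r : G -> A) (c1 : F1 -> A) (c2 : F2 -> A),
    [/\ [/\ pro2 A, continuous_hom i, continuous_hom r & cancel i r],
        continuous_hom c1, continuous_hom c2,
        i \o c1 =1 a1 /\ i \o c2 =1 a2 & pro2_coproduct c1 c2].
Proof.
move=> ha1 ha2 hb1 hb2 pG [ext ex].
have [e he [ea1 ea2 eb1 eb2]] := ex G _ _ _ _ pG ha1 ha2
  (continuous_hom_cst B1 G) (continuous_hom_cst B2 G).
have eK : forall x, e (e x) = e x.
  apply: (ext G (e \o e)) => //=; first exact: continuous_hom_comp.
  - by move=> x; have /= E := ea1 x; rewrite !E.
  - by move=> x; have /= E := ea2 x; rewrite !E.
  - by move=> x; have /= -> := eb1 x; exact: hom1 he.2.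
  - by move=> x; have /= -> := eb2 x; exact: hom1 he.2.
pose E := Idempotent he eK.
have hi := idem_val_hom E; have hr := idem_proj_hom E.
have ir := @idem_valK _ E.
have hc1 := continuous_hom_comp ha1 hr; have hc2 := continuous_hom_comp ha2 hr.
have ic1 x : idem_val (idem_proj E (a1 x)) = a1 x by rewrite idem_projK; exact: ea1.
have ic2 x : idem_val (idem_proj E (a2 x)) = a2 x by rewrite idem_projK; exact: ea2.
exists (idem_image E), (@idem_val _ E), (idem_proj E).
exists (idem_proj E \o a1), (idem_proj E \o a2).
split=> //; first by split=> //; exact: pro2_retract pG hi hr ir.
apply: pro2_coproductI => [T f f' pT hf hf' f1 f2|T f1 f2 pT h1 h2].
  have ff' : f \o idem_proj E =1 f' \o idem_proj E.
    have rb1 x : idem_proj E (b1 x) = 1%g.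
      by apply: (can_inj ir); rewrite idem_projK (hom1 hi.2); exact: eb1.
    have rb2 x : idem_proj E (b2 x) = 1%g.
      by apply: (can_inj ir); rewrite idem_projK (hom1 hi.2); exact: eb2.
    apply: ext => //; try exact: continuous_hom_comp.
      by move=> x /=; rewrite !rb1 (hom1 hf.2) (hom1 hf'.2).
    by move=> x /=; rewrite !rb2 (hom1 hf.2) (hom1 hf'.2).
  by move=> x; have := ff' (idem_val x); rewrite /= !ir.
have [f hf [fa1 fa2 _ _]] := ex T f1 f2 _ _ pT h1 h2
  (continuous_hom_cst B1 T) (continuous_hom_cst B2 T).
exists (f \o @idem_val _ E); split; first exact: continuous_hom_comp.
  by move=> x /=; rewrite ic1; exact: fa1.
by move=> x /=; rewrite ic2; exact: fa2.
Qed.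
End Coproduct4.

(** [(F1 * B1) * (F2 * B2) = (F1 * F2) * (B1 * B2)]: both factors on the right are
    images of idempotents of the group on the left. *)
Lemma coproduct_regroup (F1 F2 B1 B2 G1 G2 G : topGroupType)
    (a1 : F1 -> G1) (b1 : B1 -> G1) (a2 : F2 -> G2) (b2 : B2 -> G2)
    (j1 : G1 -> G) (j2 : G2 -> G) :
  continuous_hom a1 -> continuous_hom b1 -> continuous_hom a2 -> continuous_hom b2 ->
  continuous_hom j1 -> continuous_hom j2 -> pro2 G ->
  pro2_coproduct a1 b1 -> pro2_coproduct a2 b2 -> pro2_coproduct j1 j2 ->
  exists (A B : topGroupType) (i : A -> G) (j : B -> G)
      (c1 : F1 -> A) (c2 : F2 -> A) (d1 : B1 -> B) (d2 : B2 -> B),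
    [/\ [/\ pro2 A, pro2 B, continuous_hom i, continuous_hom j & pro2_coproduct i j],
        [/\ continuous_hom c1, continuous_hom c2 & pro2_coproduct c1 c2] &
        [/\ continuous_hom d1, continuous_hom d2 & pro2_coproduct d1 d2]].
Proof.
move=> ha1 hb1 ha2 hb2 hj1 hj2 pG u1 u2 u.
have ext (T : topGroupType) (f f' : G -> T) : pro2 T ->
    continuous_hom f -> continuous_hom f' ->
    f \o (j1 \o a1) =1 f' \o (j1 \o a1) -> f \o (j2 \o a2) =1 f' \o (j2 \o a2) ->
    f \o (j1 \o b1) =1 f' \o (j1 \o b1) -> f \o (j2 \o b2) =1 f' \o (j2 \o b2) ->
    f =1 f'.
  move=> pT hf hf' fa1 fa2 fb1 fb2.
  apply: (coproduct_ext hj1 hj2 u pT hf hf').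
    apply: (coproduct_ext ha1 hb1 u1 pT _ _ fa1 fb1); exact: continuous_hom_comp.
  apply: (coproduct_ext ha2 hb2 u2 pT _ _ fa2 fb2); exact: continuous_hom_comp.
have ex (T : topGroupType) (f1 : F1 -> T) (f2 : F2 -> T) (g1 : B1 -> T) (g2 : B2 -> T) :
     pro2 T -> continuous_hom f1 -> continuous_hom f2 ->
     continuous_hom g1 -> continuous_hom g2 ->
     exists2 f : G -> T, continuous_hom f &
       [/\ f \o (j1 \o a1) =1 f1, f \o (j2 \o a2) =1 f2,
           f \o (j1 \o b1) =1 g1 & f \o (j2 \o b2) =1 g2].
  move=> pT hf1 hf2 hg1 hg2.
  have [h1 [hh1 h1a h1b]] := coproduct_exists u1 pT hf1 hg1.
  have [h2 [hh2 h2a h2b]] := coproduct_exists u2 pT hf2 hg2.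
  have [f [hf fj1 fj2]] := coproduct_exists u pT hh1 hh2.
  exists f => //; split=> x /=.
  - by rewrite -h1a /= -fj1.
  - by rewrite -h2a /= -fj2.
  - by rewrite -h1b /= -fj1.
  - by rewrite -h2b /= -fj2.
have hja1 := continuous_hom_comp ha1 hj1; have hja2 := continuous_hom_comp ha2 hj2.
have hjb1 := continuous_hom_comp hb1 hj1; have hjb2 := continuous_hom_comp hb2 hj2.
have [A [i [r [c1 [c2 [[pA hi hr ir] hc1 hc2 [ic1 ic2] uA]]]]]] :=
  coproduct4_half hja1 hja2 hjb1 hjb2 pG (conj ext ex).
have [|B [j [r' [d1 [d2 [[pB hj hr' ir'] hd1 hd2 [jd1 jd2] uB]]]]]] :=
  coproduct4_half hjb1 hjb2 hja1 hja2 pG.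
  split=> [T f f' pT hf hf' *|T f1 f2 g1 g2 pT h1 h2 h3 h4]; first exact: ext.
  by have [f hf []] := ex T g1 g2 f1 f2 pT h3 h4 h1 h2; exists f.
exists A, B, i, j, c1, c2, d1, d2; split=> //; split=> //.
apply: pro2_coproductI => [T f f' pT hf hf' fi fj|T f1 f2 pT h1 h2].
  apply: ext => // x /=.
  - by have /= <- := ic1 x; exact: fi.
  - by have /= <- := ic2 x; exact: fi.
  - by have /= <- := jd1 x; exact: fj.
  - by have /= <- := jd2 x; exact: fj.
have [f hf [fa1 fa2 fb1 fb2]] := ex T _ _ _ _ pT
  (continuous_hom_comp hc1 h1) (continuous_hom_comp hc2 h1)
  (continuous_hom_comp hd1 h2) (continuous_hom_comp hd2 h2).
exists f; split=> //.
  apply: (coproduct_ext hc1 hc2 uA pT (continuous_hom_comp hi hf) h1) => x /=.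
    by have /= <- := fa1 x; have /= <- := ic1 x.
  by have /= <- := fa2 x; have /= <- := ic2 x.
apply: (coproduct_ext hd1 hd2 uB pT (continuous_hom_comp hj hf) h2) => x /=.
  by have /= <- := fb1 x; have /= <- := jd1 x.
by have /= <- := fb2 x; have /= <- := jd2 x.
Qed.

(** * The radical of the cup product *)

(** For the Galois group of the maximal 2-extension of a field, Kummer theory turns
    the radical of the cup product into the Kaplansky radical modulo squares. *)
Definition cup_radical_trivial (G : topGroupType) :=
  forall chi : G -> 'F_2, H1 chi ->
    (forall psi, H1 psi -> coboundary2 (cup chi psi)) -> forall g, chi g = 0.

Lemma H1_comp (G H : topGroupType) (f : H -> G) (chi : G -> 'F_2) :
  continuous_hom f -> H1 chi -> H1 (chi \o f).
Proof. by move=> hf /H1_C2 hchi; apply/H1_C2; exact: continuous_hom_comp hf hchi. Qed.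

Lemma coboundary2_comp (G H : topGroupType) (f : H -> G) (chi psi : G -> 'F_2) :
  continuous_hom f -> coboundary2 (cup chi psi) -> coboundary2 (cup (chi \o f) (psi \o f)).
Proof.
move=> [fc fM] [c cc cE]; exists (c \o f).
  by move=> x; exact: (continuous_comp (fc x) (cc _)).
by move=> g h; rewrite /cup /= fM; exact: cE (f g) (f h).
Qed.

(** Classes on a factor extend to the coproduct, so the radical of the coproduct
    restricts to the radicals of the factors. *)
Lemma cup_radical_trivial_coproduct (A B G : topGroupType) (i : A -> G) (j : B -> G) :
  continuous_hom i -> continuous_hom j -> pro2_coproduct i j ->
  cup_radical_trivial A -> cup_radical_trivial B -> cup_radical_trivial G.
Proof.
move=> hi hj u rA rB chi Hchi chiR.
have hchi : continuous_hom (chi : G -> C2) by exact/H1_C2.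
have chiA g : chi (i g) = 0.
  apply: (rA (chi \o i)) => [|psi Hpsi]; first exact: H1_comp.
  have hpsi : continuous_hom (psi : A -> C2) by exact/H1_C2.
  have [f [hf fi _]] := coproduct_exists u C2_pro2 hpsi (continuous_hom_cst B C2).
  have -> : psi = f \o i by apply/funext => x; rewrite -fi.
  by apply: coboundary2_comp => //; apply: chiR; exact/H1_C2.
have chiB g : chi (j g) = 0.
  apply: (rB (chi \o j)) => [|psi Hpsi]; first exact: H1_comp.
  have hpsi : continuous_hom (psi : B -> C2) by exact/H1_C2.
  have [f [hf _ fj]] := coproduct_exists u C2_pro2 (continuous_hom_cst A C2) hpsi.
  have -> : psi = f \o j by apply/funext => x; rewrite -fj.
  by apply: coboundary2_comp => //; apply: chiR; exact/H1_C2.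
exact: (coproduct_ext hi hj u C2_pro2 hchi (continuous_hom_cst G C2)).
Qed.

(** The union of the two bases is a basis; the retractions onto the factors make the
    inclusions injective, so that convergence to 1 can be tested on each factor. *)
Lemma free_pro2_coproduct (A B G : topGroupType) (i : A -> G) (j : B -> G) :
  continuous_hom i -> continuous_hom j -> pro2 G -> pro2_coproduct i j ->
  free_pro2 A -> free_pro2 B -> free_pro2 G.
Proof.
move=> hi hj pG u [X [pA cX uX]] [Y [pB cY uY]].
have [r [hr ri rj]] := coproduct_exists u pA (continuous_hom_id A) (continuous_hom_cst B A).
have [s [hs si sj]] := coproduct_exists u pB (continuous_hom_cst A B) (continuous_hom_id B).
exists (i @` X `|` j @` Y); split=> //.
  move=> U U1; rewrite setIUl finite_setU; split.
    apply: (@sub_finite_set _ _ (i @` (X `&` [set x | ~ (i @^-1` U) x]))).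
      by move=> _ [[x Xx <-] /= nU]; exists x.
    apply/finite_image/cX; have := hi.1 1%g; rewrite /continuous_at (hom1 hi.2); exact.
  apply: (@sub_finite_set _ _ (j @` (Y `&` [set x | ~ (j @^-1` U) x]))).
    by move=> _ [[x Xx <-] /= nU]; exists x.
  apply/finite_image/cY; have := hj.1 1%g; rewrite /continuous_at (hom1 hj.2); exact.
move=> T f pT cf.
have ir : injective i by apply: (can_inj (g := r)) => x; exact: ri.
have js : injective j by apply: (can_inj (g := s)) => x; exact: sj.
have [|f1 [[hf1 f1X] f1U]] := uX T (f \o i) pT.
  move=> U U1; apply: (@sub_finite_set _ _
      (i @^-1` ((i @` X `|` j @` Y) `&` [set x | ~ U (f x)]))).
    by move=> x [Xx nU]; split=> //; left; exists x.
  by apply: finite_preimage; [move=> ? ? ? ?; exact: ir|exact: cf].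
have [|f2 [[hf2 f2Y] f2U]] := uY T (f \o j) pT.
  move=> U U1; apply: (@sub_finite_set _ _
      (j @^-1` ((i @` X `|` j @` Y) `&` [set x | ~ U (f x)]))).
    by move=> x [Yx nU]; split=> //; right; exists x.
  by apply: finite_preimage; [move=> ? ? ? ?; exact: js|exact: cf].
have [h [hh hi1 hj2]] := coproduct_exists u pT hf1 hf2.
exists h; split; first split=> //.
  move=> _ [[x Xx <-]|[y Yy <-]]; first by have /= -> := hi1 x; exact: f1X.
  by have /= -> := hj2 y; exact: f2Y.
move=> h' [hh' h'f]; apply/funext; apply: (coproduct_ext hi hj u pT hh hh') => [x|y].
  rewrite hi1; apply: (congr1 (fun g => g x)); apply: f1U; split.
    exact: continuous_hom_comp hh'.
  by move=> z Xz; apply: h'f; left; exists z.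
rewrite hj2; apply: (congr1 (fun g => g y)); apply: f2U; split.
  exact: continuous_hom_comp hh'.
by move=> z Yz; apply: h'f; right; exists z.
Qed.

(** * Cyclotomic semidirect products *)

Lemma addF2 (x : 'F_2) : x + x = 0.
Proof. by rewrite -mulr2n -mulr_natr pchar_Zp // mulr0. Qed.

Lemma F2_cases (x : 'F_2) : x = 0 \/ x = 1.
Proof. by case: x => -[|[|[]]] // i; [left|right]; exact: val_inj. Qed.

Definition parity (u : Z2) : 'F_2 := (residue u 1)%:R.

Lemma F2_natr_mod (n : nat) : (n %% 2)%:R = n%:R :> 'F_2.
Proof. by rewrite {2}(divn_eq n 2) natrD natrM pchar_Zp // mulr0 add0r. Qed.

Lemma parityD u v : parity (u + v) = parity u + parity v.
Proof. by rewrite /parity -natrD -[RHS]F2_natr_mod. Qed.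

Lemma parityM u v : parity (u * v) = parity u * parity v.
Proof. by rewrite /parity -natrM -[RHS]F2_natr_mod. Qed.

Lemma parity1 : parity 1 = 1.
Proof. by []. Qed.

Lemma residue_nat a n : residue (a%:R : Z2) n = (a %% 2 ^ n)%N.
Proof.
elim: a => [|a IH]; first exact: erefl.
rewrite mulrS.
change ((residue (1%R : Z2) n + residue (a%:R%R : Z2) n) %% 2 ^ n = a.+1 %% 2 ^ n)%N.
by rewrite IH modnDm add1n.
Qed.

Lemma residue_modn (u : Z2) m n : (m <= n)%N -> (residue u n %% 2 ^ m = residue u m)%N.
Proof.
move=> /subnK <-; elim: (n - m)%N => [|k IH]; first by rewrite residue_mod.
by rewrite -IH addSn (residueS u (k + m)) modn_dvdm // dvdn_exp2l // leq_addl.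
Qed.

Lemma parity0_double u : parity u = 0 -> exists w, u = w + w.
Proof.
move=> u0.
have ev n : (0 < n)%N -> ~~ odd (residue u n).
  move=> n0; rewrite -eqb0 -modn2 -[2%N]expn1 residue_modn //.
  have := congr1 val u0; rewrite /parity /= Zp_nat /= => h.
  by move: (residue_mod u 1) h; rewrite /Zp_trunc /= expn1 => -> ->.
have co n : ((residue u n.+2)./2 = (residue u n.+1)./2 %[mod 2 ^ n])%N.
  by rewrite (residueS u n.+1) -!divn2 expnSr -modn_divl modn_mod.
exists (mkZ2 co); apply: residue_inj => n.
pose h := (residue u n.+1)./2.
change (residue u n = (h %% 2 ^ n + h %% 2 ^ n) %% 2 ^ n)%N.
by rewrite modnDm addnn even_halfK ?ev // -residueS.
Qed.

(** An even 2-adic integer is a double, and doubles die in F_2. *)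
Lemma additive_F2_parity m (f : 'rV[Z2]_m -> 'F_2) (u : Z2) z :
  {morph f : x y / x + y} -> f (u *: z) = parity u * f z.
Proof.
move=> fD.
have f0 : f 0 = 0 by apply: (addrI (f 0)); rewrite -fD !addr0.
have ev v : parity v = 0 -> f (v *: z) = 0.
  by move=> /parity0_double[w ->]; rewrite scalerDl fD addF2.
have [p0|p1] := eqVneq (parity u) 0; first by rewrite ev ?p0 ?mul0r.
have {}p1 : parity u = 1 by case: (F2_cases (parity u)) p1 => // ->; rewrite eqxx.
rewrite p1 mul1r -{1}[u](subrK 1) scalerDl fD scale1r ev ?add0r //.
apply: (addIr (parity 1)); rewrite -parityD subrK p1 add0r; exact: parity1.
Qed.

Section Semidirect.
Variables (m : nat) (P : cyclotomic_pair).
Notation S := (sdprod_pair m P).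
Implicit Types (z : 'rV[Z2]_m) (g : P).

Definition sd_inl z : S := (z, 1%g).
Definition sd_inr g : S := (0, g).

Lemma parity_char g : parity (pair_char g) = 1.
Proof.
have [_ t1 tM] := pair_charP P.
have : parity (pair_char g) * parity (pair_char g^-1%g) = 1.
  by rewrite -parityM -tM mulgV t1 parity1.
by case: (F2_cases (parity (pair_char g))) => // ->; rewrite mul0r.
Qed.

Lemma sd_inlD z z' : sd_inl (z + z') = (sd_inl z * sd_inl z')%g.
Proof.
have [_ t1 _] := pair_charP P.
by rewrite /sd_inl /mulg /= /sdprod_mul /= t1 scale1r mulg1.
Qed.

Lemma sd_inlr z g : (sd_inl z * sd_inr g)%g = (z, g).
Proof. by rewrite /mulg /= /sdprod_mul /= scaler0 addr0 mul1g. Qed.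

Lemma sd_inrl g z : (sd_inr g * sd_inl z)%g = (sd_inl (pair_char g *: z) * sd_inr g)%g.
Proof. by rewrite sd_inlr /mulg /= /sdprod_mul /= add0r mulg1. Qed.

Lemma sd_inr_hom : continuous_hom sd_inr.
Proof.
split=> [g|g h]; last by rewrite /sd_inr /mulg /= /sdprod_mul /= scaler0 addr0.
by apply: sdprod_pairP => /=; [exact: cst_continuous|exact: cvg_id].
Qed.

Lemma sd_snd_hom : continuous_hom (fun x : S => x.2 : P).
Proof. by split=> // x; exact: sdprod_snd_continuous. Qed.

Lemma H1_coord i : H1 (fun x : S => parity (x.1 ord0 i)).
Proof.
split=> [x A xA|x y]; last first.
  by rewrite /mulg /= /sdprod_mul /= !mxE parityD parityM parity_char mul1r.
have /rV_cvgP/(_ i 1%N) := @sdprod_fst_continuous m P x.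
rewrite /= nbhs_simpl; apply: filterS => y /= yx.
by rewrite /parity yx; exact: nbhs_singleton xA.
Qed.

Lemma H1_snd psi : H1 psi -> H1 (fun x : S => psi (x.2 : P)).
Proof. exact: (H1_comp sd_snd_hom). Qed.

(** Write the cup product as the coboundary of [c] and compare its values at [(g, z)]
    and at [(g z g^-1, g)], two pairs with the same product. Conjugation by [g] acts
    on [Z_2 ^ m] through an odd scalar, which [c] ignores, being additive there. *)
Lemma coboundary2_sd (chi psi : S -> 'F_2) :
  coboundary2 (cup chi psi) -> H1 chi ->
  (forall z z', chi (sd_inl z) * psi (sd_inl z') = 0) ->
  forall z g, chi (sd_inr g) * psi (sd_inl z) = chi (sd_inl z) * psi (sd_inr g).
Proof.
move=> [c _ cE] [_ chiM] zz z g.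
have cD : {morph (fun z => c (sd_inl z)) : x y / x + y}.
  move=> x y; have := cE (sd_inl x) (sd_inl y); rewrite /cup /= zz -sd_inlD => /esym/eqP.
  by rewrite addrAC subr_eq0 addrC => /eqP.
have chiD : {morph (fun z => chi (sd_inl z)) : x y / x + y}.
  by move=> x y; rewrite sd_inlD chiM.
have := cE (sd_inr g) (sd_inl z); rewrite /cup /= => ->.
have := cE (sd_inl (pair_char g *: z)) (sd_inr g); rewrite /cup /= -sd_inrl.
rewrite (additive_F2_parity _ _ chiD) (additive_F2_parity _ _ cD) parity_char !mul1r => ->.
by rewrite addrC addrA addrAC.
Qed.

(** If [P] is the pair of a field [k], the semidirect product is that of the iterated
    Laurent series field in [m] variables over [k]. A class that is nonzero on
    [Z_2 ^ m] has nonzero cup product with the class of another variable or with a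
    nonzero class of [P]; a nonzero class of [P] has nonzero cup product with the
    class of each variable. *)
Lemma cup_radical_trivial_sd :
  (1 < m)%N \/ (0 < m)%N /\ (exists psi, H1 psi /\ exists g : P, psi g <> 0) ->
  cup_radical_trivial S.
Proof.
move=> mP chi Hchi chiR.
have chiM := Hchi.2.
have chiD : {morph (fun z => chi (sd_inl z)) : x y / x + y}.
  by move=> x y; rewrite sd_inlD chiM.
have chi0 : chi (sd_inl 0) = 0.
  by apply: (addrI (chi (sd_inl 0))); rewrite -chiD !addr0.
have m0 : (0 < m)%N by case: mP => [/ltnW|[]].
have chiz z : chi (sd_inl z) = 0.
  case: mP => [m1|[_ [psi [Hpsi [g psig]]]]]; last first.
    have psi1 : psi 1%g = 0 by apply: (addrI (psi 1%g)); rewrite -Hpsi.2 mulg1 addr0.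
    have := coboundary2_sd (chiR _ (H1_snd Hpsi)) Hchi _ z g.
    rewrite /= psi1 mulr0 => /(_ _)/esym/eqP; rewrite mulf_eq0 => /(_ _)/orP[].
    - by move=> *; rewrite mulr0.
    - by move=> /eqP.
    - by move=> /eqP.
  suff chiu u i : chi (sd_inl (u *: delta_mx ord0 i)) = 0.
    rewrite [z]row_sum_delta; elim/big_rec: _ => // i y _ IH.
    by rewrite chiD IH chiu addr0.
  have [j ji] : exists j : 'I_m, j != i.
    have [i0|i0] := eqVneq (i : nat) 0%N.
      by exists (Ordinal m1); rewrite -val_eqE /= i0.
    by exists (Ordinal m0); rewrite -val_eqE /= eq_sym.
  have [c _ cE] := chiR _ (H1_coord j).
  pose e := sd_inl (delta_mx ord0 j); pose ui := sd_inl (u *: delta_mx ord0 i).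
  (* A coboundary takes the same value at [(x, y)] and [(y, x)] if [x] and [y] commute. *)
  pose f := cup chi (fun x : S => parity (x.1 ord0 j)).
  have : f (ui, e) = f (e, ui).
    rewrite /f !cE (_ : e * ui = ui * e)%g; last by rewrite -!sd_inlD addrC.
    by rewrite addrC addrA addrAC.
  by rewrite /f /cup /= !mxE !eqxx (negbTE ji) /= mulr1 mulr0 mulr0.
have chig g : chi (sd_inr g) = 0.
  pose i := Ordinal m0.
  have := coboundary2_sd (chiR _ (H1_coord i)) Hchi _ (delta_mx ord0 i) g.
  rewrite /= !mxE !eqxx chiz mul0r parity1 mulr1; apply.
  by move=> *; rewrite chiz mul0r.
by case=> z g; rewrite -sd_inlr chiM chiz chig addr0.
Qed.

End Semidirect.

(** * The free pro-2 group of rank one *)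

Lemma lcongrX_mod (G : groupType) (N : set G) k (t : G) a b :
  normal_subgroup N -> has_index N (2 ^ k)%N ->
  (a = b %[mod 2 ^ k])%N -> N ((t ^+ a)^-1 * t ^+ b)%g.
Proof.
move=> nN iN ab.
have red c : N ((t ^+ (c %% 2 ^ k))^-1 * t ^+ c)%g.
  rewrite {2}(divn_eq c (2 ^ k)) addnC expgD mulKg mulnC expgM.
  have [[N1 M _] _] := nN; elim: (c %/ _)%N => [|q IH]; first by rewrite expg0.
  by rewrite expgS; apply: M => //; exact: index_pow_mem.
apply: (lcongr_trans (y := (t ^+ (a %% 2 ^ k))%g) nN.1); last by rewrite ab.
exact: lcongr_sym nN.1 _.
Qed.

Lemma pro2_separated (T : topGroupType) (x y : T) : pro2 T ->
  (forall N k, open N -> normal_subgroup N -> has_index N (2 ^ k)%N -> N (x^-1 * y)%g) ->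
  x = y.
Proof.
move=> pT xyN; have [_ hT _ _] := pT; apply: hT => A B xA yB.
have : nbhs (x * 1)%g A by rewrite mulg1.
move=> /(mulg_continuousl (a := x)); rewrite nbhs_simpl => /= A1.
have [N [oN nN NA [k iN]]] := open_normal_basis pT A1.
exists y; split; last exact: nbhs_singleton yB.
by have := NA _ (xyN N k oN nN iN); rewrite /= mulKVg.
Qed.

(** The exponentiation [u |-> t ^ u]: its value is a cluster point of the powers of
    [t] with exponents the residues of [u], which stabilise modulo every open normal
    subgroup. *)
Lemma Z2_power (T : topGroupType) (t : T) : pro2 T ->
  exists f : Z2 -> T, [/\ continuous f, forall u v, f (u + v) = (f u * f v)%g & f 1 = t].
Proof.
move=> pT; have [cT hT _ _] := pT.
have ex (u : Z2) : exists y : T, forall N k, open N -> normal_subgroup N ->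
    has_index N (2 ^ k)%N -> N (y^-1 * t ^+ residue u k)%g.
  have [y [_ yc]] := cT ((fun n => (t ^+ residue u n)%g) @ \oo) _ filterT.
  exists y => N k oN nN iN.
  have [] := yc [set (t ^+ residue u n)%g | n in [set n | (k <= n)%N]]
      [set z | N (y^-1 * z)%g].
  - by exists k => // n kn; exists n.
  - by apply: open_nbhs_nbhs; split; [exact: open_lcoset|rewrite /= mulVg; case: nN => -[]].
  move=> _ [[n /= kn <-] Ny]; apply: (lcongr_trans nN.1 Ny).
  by apply: (lcongrX_mod _ nN iN); rewrite residue_modn // residue_mod.
have [f fN] := choice ex.
exists f; split.
- move=> u A fA.
  have : nbhs (f u * 1)%g A by rewrite mulg1.
  move=> /(mulg_continuousl (a := f u)); rewrite nbhs_simpl => /= A1.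
  have [N [oN nN NA [k iN]]] := open_normal_basis pT A1.
  apply/Z2_nbhsP; exists k => v vu /=.
  have : N ((f u)^-1 * f v)%g.
    apply: (lcongr_trans nN.1 (fN u N k oN nN iN)); rewrite -vu.
    by apply: (lcongr_sym nN.1); exact: fN.
  by move=> /NA; rewrite /= mulKVg.
- move=> u v; apply: pro2_separated => // N k oN nN iN.
  apply: (lcongr_trans nN.1 (fN _ N k oN nN iN)).
  apply: (lcongr_sym nN.1).
  apply: (lcongr_trans nN.1 (lcongrM nN (fN u N k oN nN iN) (fN v N k oN nN iN))).
  by rewrite -expgD; apply: (lcongrX_mod _ nN iN); rewrite /= modn_mod.
- apply: pro2_separated => // N k oN nN iN.
  apply: (lcongr_trans nN.1 (fN _ N k oN nN iN)).
  rewrite -[X in (_ * X)%g]expg1.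
  by apply: (lcongrX_mod _ nN iN); rewrite /= modn_mod.
Qed.

(** The natural numbers are dense in [Z_2]. *)
Lemma Z2_power_unique (T : topGroupType) (f h : Z2 -> T) : pro2 T ->
  continuous f -> {morph f : u v / u + v >-> (u * v)%g} ->
  continuous h -> {morph h : u v / u + v >-> (u * v)%g} -> f 1 = h 1 -> f =1 h.
Proof.
move=> pT fc fD hc hD fh u.
have nat_eq (g : Z2 -> T) : {morph g : u v / u + v >-> (u * v)%g} ->
    forall a : nat, g a%:R = (g 1%R ^+ a)%g.
  move=> gD; elim=> [|a IH]; last by rewrite mulrS gD IH expgS.
  by rewrite expg0; apply: (@mulgI _ (g 0)); rewrite -gD addr0 mulg1.
have near (g : Z2 -> T) (N : set T) : continuous g -> open N -> normal_subgroup N ->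
    exists n, forall v, residue v n = residue u n -> N ((g u)^-1 * g v)%g.
  move=> gc oN nN; apply/Z2_nbhsP/(gc u [set z | N ((g u)^-1 * z)%g]).
  by apply: open_nbhs_nbhs; split; [exact: open_lcoset|rewrite /= mulVg; case: nN => -[]].
apply: pro2_separated => // N k oN nN iN.
have [n nf] := near f N fc oN nN; have [n' nh] := near h N hc oN nN.
pose a := residue u (maxn n n').
apply: (lcongr_trans nN.1 (nf a%:R _)).
  by rewrite residue_nat residue_modn // leq_maxl.
rewrite nat_eq // fh -nat_eq //; apply: (lcongr_sym nN.1); apply: nh.
by rewrite residue_nat residue_modn // leq_maxr.
Qed.

Lemma sd_free (P : cyclotomic_pair) : (forall g : P, g = 1%g) -> pro2 (sdprod_pair 1 P) ->
  free_pro2 (sdprod_pair 1 P).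
Proof.
move=> P1 pS; pose e : sdprod_pair 1 P := sd_inl P (const_mx 1).
pose co (x : sdprod_pair 1 P) : Z2 := x.1 ord0 ord0.
pose io (u : Z2) : sdprod_pair 1 P := sd_inl P (const_mx u).
have coK : cancel co io.
  case=> z g; rewrite /io /sd_inl -(P1 g); congr pair.
  by apply/matrixP => i j; rewrite mxE !ord1.
have ioD : {morph io : u v / u + v >-> (u * v)%g}.
  by move=> u v; rewrite -sd_inlD; congr sd_inl; apply/matrixP => i j; rewrite !mxE.
have coD x y : co (x * y)%g = co x + co y.
  by rewrite -[x in LHS]coK -[y in LHS]coK -ioD /co /= mxE.
have ioc : continuous io.
  move=> u; apply: sdprod_pairP => /=; last exact: cst_continuous.
  apply/rV_cvgP => i n; apply/Z2_nbhsP; exists n => v; by rewrite /= !mxE.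
have coc : continuous co.
  move=> x; apply/Z2_cvgP => n.
  by have /rV_cvgP/(_ ord0 n) := @sdprod_fst_continuous 1 P x.
exists [set e]; split=> //.
  by move=> U _; apply: (@sub_finite_set _ _ [set e]); [move=> x []|exact: finite_set1].
move=> T f pT _; have [p [pc pD pe]] := Z2_power (f e) pT.
have hp : continuous_hom (p \o co).
  split=> [x|x y /=]; last by rewrite coD pD.
  exact: (continuous_comp (coc x) (pc _)).
exists (p \o co); split; first by split=> // x ->; rewrite /= /co mxE.
move=> h [[hc hM] he]; apply/funext => x; rewrite -[x]coK /=.
have -> : co (io (co x)) = co x by rewrite coK.
apply: (Z2_power_unique (f := p) (h := h \o io)) => //.
- by move=> u; exact: (continuous_comp (ioc u) (hc _)).
- by move=> u v /=; rewrite ioD hM.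
- by rewrite /= pe -(he e).
Qed.

(** * Decomposition of the groups of elementary type *)

Definition free_times_nondegenerate (G : topGroupType) :=
  exists (A B : topGroupType) (i : A -> G) (j : B -> G),
    [/\ [/\ pro2 A, pro2 B, continuous_hom i & continuous_hom j],
        pro2_coproduct i j, free_pro2 A & cup_radical_trivial B].

Lemma trivial_group_free : free_pro2 trivial_group.
Proof.
exists set0; split; first exact: trivial_group_pro2.
  by move=> U _; rewrite set0I; exact: finite_set0.
move=> T f pT _; exists (fun=> 1%g); split; first by split=> //; exact: continuous_hom_cst.
by move=> h [[_ hM] _]; apply/funext => -[]; rewrite (hom1 hM).
Qed.

Lemma trivial_group_cup_radical : cup_radical_trivial trivial_group.
Proof.
move=> chi [_ chiM] _ []; apply: (addrI (chi tt)).
by rewrite -chiM addr0.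
Qed.

(** An isomorphism is a coproduct with the trivial group; thus the results on
    coproducts transport freeness and triviality of the radical along it. *)
Lemma coproduct_iso_trivial (A G : topGroupType) (f : A -> G) (g : G -> A) :
  continuous_hom f -> continuous_hom g -> cancel g f -> cancel f g ->
  pro2_coproduct f (fun _ : trivial_group => 1%g : G).
Proof.
move=> hf hg gf fg; apply: pro2_coproductI => [T h h' _ _ _ hh' _ x|T f1 f2 pT h1 h2].
  by rewrite -[x]gf; exact: hh'.
exists (f1 \o g); split; first exact: continuous_hom_comp.
  by move=> x /=; rewrite fg.
by case; rewrite /= (hom1 hg.2) (hom1 h1.2) (hom1 h2.2).
Qed.

Lemma coproduct_trivial_id (G : topGroupType) :
  pro2_coproduct (fun _ : trivial_group => 1%g : G) (@id G).
Proof.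
apply: pro2_coproductI => [T f f' _ _ _ _ + x|T f1 f2 pT h1 h2]; first exact.
exists f2; split=> // -[]; by rewrite /= (hom1 h1.2) (hom1 h2.2).
Qed.

Lemma free_decomposition (G : topGroupType) :
  pro2 G -> free_pro2 G -> free_times_nondegenerate G.
Proof.
move=> pG fG; exists G, trivial_group, id, (fun=> 1%g).
split=> //; last exact: trivial_group_cup_radical.
  split=> //; [exact: trivial_group_pro2|exact: continuous_hom_id|exact: continuous_hom_cst].
by apply: (coproduct_iso_trivial (g := id)) => //; exact: continuous_hom_id.
Qed.

Lemma nondegenerate_decomposition (G : topGroupType) :
  pro2 G -> cup_radical_trivial G -> free_times_nondegenerate G.
Proof.
move=> pG fG; exists trivial_group, G, (fun=> 1%g), id.
split=> //; last exact: trivial_group_free.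
  split=> //; [exact: trivial_group_pro2|exact: continuous_hom_cst|exact: continuous_hom_id].
exact: coproduct_trivial_id.
Qed.

(** In a semidirect product [Z_2 ^ m] by [P] the radical is trivial, unless [m = 1]
    and [P] has no nonzero class; then [P] is trivial and the product is free. *)
Lemma elementary_type_decomposition (P : cyclotomic_pair) :
  elementary_type P -> pro2 P -> free_times_nondegenerate P.
Proof.
elim=> {P} [Om E _ _ fE _|Om E _ _ [_ _ _ [nd _]]
  |P1 P2 P _ IH1 _ IH2 [p1 p2 _ [i1 [i2 [m1 m2 u]]]]|m P m0 _ _|P Q _ IH PQ] pG.
- exact: free_decomposition.
- exact: nondegenerate_decomposition.
- have [F1 [B1 [a1 [b1 [[pF1 pB1 ha1 hb1] u1 fF1 rB1]]]]] := IH1 p1.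
  have [F2 [B2 [a2 [b2 [[pF2 pB2 ha2 hb2] u2 fF2 rB2]]]]] := IH2 p2.
  have [A [B [i [j [c1 [c2 [d1 [d2 [[pA pB hi hj uG] [hc1 hc2 uA] [hd1 hd2 uB]]]]]]]]]] :=
    coproduct_regroup ha1 hb1 ha2 hb2 m1.1 m2.1 pG u1 u2 u.
  exists A, B, i, j; split=> //.
    exact: free_pro2_coproduct hc1 hc2 pA uA fF1 fF2.
  exact: cup_radical_trivial_coproduct hd1 hd2 uB rB1 rB2.
- have pP : pro2 P.
    exact: (pro2_retract pG (sd_inr_hom m P) (sd_snd_hom m P)).
  have [m1|m1] := ltnP 1 m.
    by apply: nondegenerate_decomposition => //; apply: cup_radical_trivial_sd; left.
  have [P1|/existsNP[g /eqP g1]] := pselect (forall g : P, g = 1%g); last first.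
    apply: nondegenerate_decomposition => //; apply: cup_radical_trivial_sd; right.
    by split=> //; exact: pro2_nontrivial_H1 g1.
  have {m0 m1} em : m = 1%N by apply/eqP; rewrite eqn_leq m1.
  by subst m; apply: free_decomposition => //; exact: sd_free.
- have [f [f' [[hf _] [hf' _] ff' f'f]]] := PQ.
  have pP : pro2 P := pro2_retract pG hf hf' ff'.
  have [A [B [i [j [[pA pB hi hj] u fA rB]]]]] := IH pP.
  exists A, B, (f \o i), (f \o j); split=> //.
    by split=> //; exact: continuous_hom_comp.
  apply: pro2_coproductI => [T g g' pT hg hg' gi gj x|T f1 f2 pT h1 h2].
    rewrite -[x]f'f.
    have [hgf hgf'] := (continuous_hom_comp hf hg, continuous_hom_comp hf hg').
    exact: (coproduct_ext hi hj u pT hgf hgf' gi gj).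
  have [g [hg gi gj]] := coproduct_exists u pT h1 h2.
  exists (g \o f'); split; first exact: continuous_hom_comp.
    by move=> x /=; rewrite ff'; exact: gi.
  by move=> x /=; rewrite ff'; exact: gj.
Qed.

(** * Embeddings into the separable closure *)

Section PartialEmbeddings.
Variables (Om : fieldType) (F : divringClosed Om).

(** Partial embeddings are encoded by their graphs, subfields of [Om * Om] meeting
    [0 * Om] trivially, so that unions of chains are plain unions of sets. *)
Definition is_pemb (R : set (Om * Om)) :=
  [/\ forall c, c \in F -> R (c, c),
      forall u v u' v', R (u, v) -> R (u', v') -> R (u - u', v - v'),
      forall u v u' v', R (u, v) -> R (u', v') -> R (u / u', v / v') &
      forall v, R (0, v) -> v = 0].

Record pemb := Pemb { pemb_graph :> Om * Om -> Prop; pembP : is_pemb pemb_graph }.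

Section OnePartialEmbedding.
Variable r : pemb.

Definition pdom : {pred Om} := fun u => `[< exists v, r (u, v) >].

Lemma pdom_divring_closed : divring_closed pdom.
Proof.
have [rF rB rM _] := pembP r.
split=> [|x y /asboolP[v xv] /asboolP[w yw]|x y /asboolP[v xv] /asboolP[w yw]].
- by apply/asboolP; exists 1; apply: rF; exact: rpred1.
- by apply/asboolP; exists (v - w); exact: rB.
- by apply/asboolP; exists (v / w); exact: rM.
Qed.

HB.instance Definition _ := GRing.isDivringClosed.Build Om pdom pdom_divring_closed.

Notation S := (subfield_type pdom).

Lemma pdom_ex (u : S) : exists v, r (val u, v).
Proof. exact/asboolP/(valP u). Qed.

Definition pfun (u : S) : Om := projT1 (cid (pdom_ex u)).

Lemma pfunP u : r (val u, pfun u).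
Proof. by rewrite /pfun; case: cid. Qed.

Lemma pfun_eq (u : S) v : r (val u, v) -> pfun u = v.
Proof.
have [_ rB _ r0] := pembP r.
move=> uv; apply/eqP; rewrite -subr_eq0; apply/eqP/r0.
by rewrite -(subrr (val u)); apply: rB => //; exact: pfunP.
Qed.

Lemma pfunB : {morph pfun : x y / x - y}.
Proof.
have [_ rB _ _] := pembP r.
by move=> x y; apply: pfun_eq; rewrite rmorphB; apply: rB; exact: pfunP.
Qed.

Lemma pfun1 : pfun 1 = 1.
Proof.
have [rF _ _ _] := pembP r.
by apply: pfun_eq; rewrite rmorph1; apply: rF; exact: rpred1.
Qed.

Lemma pfunM : {morph pfun : x y / x * y}.
Proof.
have [rF _ rM _] := pembP r.
have rV u v : r (u, v) -> r (u^-1, v^-1).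
  by rewrite -[u^-1]mul1r -[v^-1]mul1r; apply: rM; apply: rF; exact: rpred1.
move=> x y; apply: pfun_eq; rewrite rmorphM /=.
by rewrite -[val y]invrK -[pfun y]invrK; apply: rM; [|apply: rV]; exact: pfunP.
Qed.

HB.instance Definition _ := GRing.isZmodMorphism.Build S Om pfun pfunB.
HB.instance Definition _ := GRing.isMonoidMorphism.Build S Om pfun (conj pfun1 pfunM).

Definition pdom_lift (p : {poly S}) : {poly Om} := map_poly val p.
Definition pfun_lift (p : {poly S}) : {poly Om} := map_poly pfun p.

Lemma base_in_pdom c : c \in F -> c \in pdom.
Proof. by have [rF _ _ _] := pembP r; move=> cF; apply/asboolP; exists c; exact: rF. Qed.

Lemma base_poly (p : {poly subfield_type F}) :
  exists q : {poly S}, pdom_lift q = map_poly val p /\ pfun_lift q = map_poly val p.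
Proof.
have [rF _ _ _] := pembP r.
pose incl (c : subfield_type F) : S := SubfieldElt (base_in_pdom (valP c)).
have coef (f : {rmorphism S -> Om}) : (forall c, f (incl c) = val c) ->
    map_poly f (\poly_(i < size p) incl p`_i) = map_poly val p.
  move=> fi; apply/polyP => i; rewrite !coef_map coef_poly.
  case: ltnP => ip; first exact: fi.
  by rewrite (nth_default _ ip) !raddf0.
exists (\poly_(i < size p) incl p`_i); split; apply: coef => // c.
by apply: pfun_eq; exact: (rF _ (valP c)).
Qed.

(** Only the divisibility property of the minimal polynomial is recorded. Its image
    under the embedding is separable because it divides a separable polynomial over
    [F], which the embedding fixes. *)
Lemma minimal_poly x : separable_over F x ->
  exists m : {poly S}, [/\ forall p, root (pdom_lift p) x = (m %| p),
    m != 0 & separable_poly (pfun_lift m)].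
Proof.
move=> [f fsep fx]; have [q [qv qp]] := base_poly f.
have q0 : q != 0.
  rewrite -(map_poly_eq0 (val : {rmorphism S -> Om})) -/(pdom_lift q) qv map_poly_eq0.
  exact: separable_poly_neq0.
pose good n := `[< exists p : {poly S}, [/\ p != 0, root (pdom_lift p) x & size p = n] >].
have exn : exists n, good n by exists (size q); apply/asboolP; exists q; rewrite qv.
have [n /asboolP[m [m0 mx ms]] nmin] := ex_minnP exn.
have mdvd p : root (pdom_lift p) x = (m %| p).
  apply/idP/idP => [px|/dvdpP[d ->]]; last first.
    by rewrite /pdom_lift rmorphM rootM (mx : root (map_poly _ m) x) orbT.
  rewrite /dvdp; apply: contraT => r0.
  have : (n <= size (p %% m)%R)%N.
    apply: nmin; apply/asboolP; exists (p %% m); split=> //.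
    have /= := congr1 (fun p => (pdom_lift p).[x]) (divp_eq p m).
    rewrite /pdom_lift rmorphD rmorphM hornerD hornerM (rootP px) (rootP mx) mulr0 add0r.
    by move/esym/eqP.
  by rewrite -ms leqNgt ltn_modp m0.
exists m; split=> //.
have : pfun_lift m %| pfun_lift q by rewrite dvdp_map -mdvd qv.
by move/dvdp_separable; apply; rewrite qp separable_map.
Qed.

(** The pairs of values at [x] and [y] of the polynomials over the domain form the
    larger graph: divisibility by [m] makes the second value depend on the first only,
    and a Bezout identity with [m] provides the inverses. *)
Lemma pemb_adjoin (m : {poly S}) x y :
  (forall p, root (pdom_lift p) x = (m %| p)) -> m != 0 -> root (pfun_lift m) y ->
  exists r' : pemb, (forall p, r p -> r' p) /\ r' (x, y).
Proof.
move=> mP m0 my.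
have val_ev c z : (pdom_lift c%:P).[z] = val c by rewrite /pdom_lift map_polyC hornerC.
have pfun_ev c z : (pfun_lift c%:P).[z] = pfun c by rewrite /pfun_lift map_polyC hornerC.
have py p : root (pdom_lift p) x -> (pfun_lift p).[y] = 0.
  by rewrite mP => /dvdpP[d ->]; rewrite /pfun_lift rmorphM hornerM (rootP my) mulr0.
have inv p : ~~ root (pdom_lift p) x -> exists q, (pdom_lift q).[x] = (pdom_lift p).[x]^-1 /\
    (pfun_lift q).[y] = (pfun_lift p).[y]^-1.
  move=> px; have cop : coprimep p m.
    have gm := dvdp_gcdr p m; have gp := dvdp_gcdl p m.
    case/dvdpP: gm => h mE.
    have : root (pdom_lift m) x by rewrite mP dvdpp.
    rewrite {1}mE /pdom_lift rmorphM rootM => /orP[]; rewrite -/(pdom_lift _) mP.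
      move=> mh; have h0 : h != 0 by apply: contraNneq m0 => h0; rewrite mE h0 mul0r.
      have g0 : gcdp p m != 0 by apply: contraNneq m0 => g0; rewrite mE g0 mulr0.
      have ms : size m = (size h + size (gcdp p m)).-1 by rewrite {1}mE size_mul.
      have := dvdp_leq h0 mh; rewrite /coprimep ms.
      have : (0 < size (gcdp p m))%N by rewrite size_poly_gt0.
      have : (0 < size h)%N by rewrite size_poly_gt0.
      case: (size h) (size (gcdp p m)) => [|a] [|[|b]] //.
      by rewrite addSn /= !addnS !ltnS ltnNge leq_addr.
    by move=> /dvdp_trans/(_ gp); rewrite -mP (negbTE px).
  have [[u v] /= uv] := Bezout_eq1_coprimepP _ _ cop; exists u.
  have ux : (pdom_lift u).[x] * (pdom_lift p).[x] = 1.
    have := congr1 (fun p => (pdom_lift p).[x]) uv.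
    rewrite /pdom_lift rmorphD !rmorphM rmorph1 hornerD !hornerM hornerC.
    have /rootP -> : root (pdom_lift m) x by rewrite mP dvdpp.
    by rewrite mulr0 addr0.
  have uy : (pfun_lift u).[y] * (pfun_lift p).[y] = 1.
    have := congr1 (fun p => (pfun_lift p).[y]) uv.
    rewrite /pfun_lift rmorphD !rmorphM rmorph1 hornerD !hornerM hornerC.
    by rewrite (rootP my) mulr0 addr0.
  have eqV (a b : Om) : a * b = 1 -> a = b^-1.
    move=> ab; have b0 : b != 0.
      by apply: contra_eq_neq ab => ->; rewrite mulr0 eq_sym oner_eq0.
    by apply: (mulIf b0); rewrite ab mulVf.
  by split; exact: eqV.
pose R' := [set uv | exists p : {poly S}, uv = ((pdom_lift p).[x], (pfun_lift p).[y])].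

have R'B u v u' v' : R' (u, v) -> R' (u', v') -> R' (u - u', v - v').
  move=> [p [-> ->]] [q [-> ->]]; exists (p - q).
  by rewrite /pdom_lift /pfun_lift !rmorphB !hornerD !hornerN.
have R'M u v u' v' : R' (u, v) -> R' (u', v') -> R' (u * u', v * v').
  move=> [p [-> ->]] [q [-> ->]]; exists (p * q).
  by rewrite /pdom_lift /pfun_lift !rmorphM !hornerM.
have rR' p : r p -> R' p.
  case: p => u v uv; have uS : u \in pdom by apply/asboolP; exists v.
  exists (SubfieldElt uS)%:P; rewrite val_ev pfun_ev; congr pair.
  exact/esym/pfun_eq.
have R'P : is_pemb R'.
  have [rF _ _ _] := pembP r; split=> //.
  - by move=> c cF; apply/rR'/rF.
  - move=> u v u' v' uv [p [-> ->]]; apply: R'M => //.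
    have [|/inv[q [<- <-]]] := boolP (root (pdom_lift p) x); last by exists q.
    move=> /[dup] /py -> /rootP ->.
    by rewrite invr0; apply/rR'/rF; exact: rpred0.
  - by move=> v [p [/esym/eqP px ->]]; exact: py.
exists (Pemb R'P); split=> //.
by exists 'X; rewrite /pdom_lift /pfun_lift !map_polyX !hornerX.
Qed.

End OnePartialEmbedding.

Hypothesis sepOm : separable_closure F.

Lemma pemb_maximal (r : pemb) : exists r' : pemb, (forall p, r p -> r' p) /\
  forall r'' : pemb, (forall p, r' p -> r'' p) -> forall p, r'' p -> r' p.
Proof.
(* Joining [r] to all sets makes the union of the empty chain admissible. *)
pose P (X : set (Om * Om)) := is_pemb (r `|` X).
have [|A [PA Amax]] := @Zorn_bigcup _ P.
  move=> C CP Ctot.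
  have [rF rB rM r0] := pembP r.
  have ex p q : (r `|` \bigcup_(X in C) X) p -> (r `|` \bigcup_(X in C) X) q ->
      exists X, [/\ P X, (r `|` X) p, (r `|` X) q & r `|` X `<=` r `|` \bigcup_(X in C) X].
    have P0 : P set0 by rewrite /P setU0; exact: pembP.
    have sub X : C X -> r `|` X `<=` r `|` \bigcup_(X in C) X.
      by move=> CX; apply: setUS => z Xz; exists X.
    move=> [rp|[X CX Xp]] [rq|[Y CY Yq]].
    - by exists set0; split=> //; [left|left|rewrite setU0; exact: subsetUl].
    - by exists Y; split; [exact: CP|left|right|exact: sub].
    - by exists X; split; [exact: CP|right|left|exact: sub].
    - have [XY|YX] := Ctot _ _ CX CY.
        by exists Y; split; [exact: CP|right; exact: XY|right|exact: sub].
      by exists X; split; [exact: CP|right|right; exact: YX|exact: sub].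
  split=> [c cF|u v u' v' uv uv'|u v u' v' uv uv'|v uv].
  - by left; exact: rF.
  - by have [X [[_ XB _ _] Xp Xq Xs]] := ex _ _ uv uv'; apply/Xs/XB.
  - by have [X [[_ _ XM _] Xp Xq Xs]] := ex _ _ uv uv'; apply/Xs/XM.
  - by have [X [[_ _ _ X0] Xp _ _]] := ex _ _ uv uv; exact: X0.
exists (Pemb PA); split=> [p rp|r'' rr'' p r''p]; first by left.
apply: contrapT => /= nAp; apply: (Amax r'').
  split; first by move=> z Az; apply: rr''; right.
  by move=> AE; apply: nAp; right; exact: AE.
rewrite /P (_ : _ `|` _ = r''); first exact: pembP.
by apply/seteqP; split=> z; [case=> // rz; apply: rr''; left|right].
Qed.

(** A maximal partial embedding is total: the image of the minimal polynomial of an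
    element outside its domain has a root, since it is separable. *)
Lemma pemb_extend (r : pemb) : exists s : {rmorphism Om -> Om},
  (forall c, c \in F -> s c = c) /\ forall u v, r (u, v) -> s u = v.
Proof.
have [r' [rr' r'max]] := pemb_maximal r.
have total x : exists v, r' (x, v).
  have [m [mP m0 msep]] := minimal_poly r' (sepOm.1 x).
  have [y my] : exists y, root (pfun_lift m) y.
    apply: sepOm.2 => //; rewrite size_map_poly ltnNge.
    apply: contraL (dvdpp m) => m1.
    rewrite -mP (size1_polyC m1) /pdom_lift map_polyC rootC fmorph_eq0.
    by apply: contra m0 => /eqP m00; rewrite (size1_polyC m1) m00.
  have [r'' [r'r'' r''x]] := pemb_adjoin mP m0 my.
  by exists y; apply: (r'max r'').
have [s sP] := choice total.
have [rF rB rM r0] := pembP r'.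
have sE u v : r' (u, v) -> s u = v.
  move=> uv; apply/eqP; rewrite -subr_eq0; apply/eqP/r0.
  by rewrite -(subrr u); exact: rB.
have sB : {morph s : x y / x - y} by move=> x y; apply: sE; exact: rB.
have s1 : s 1 = 1 by apply/sE/rF; exact: rpred1.
have sV x : r' (x^-1, (s x)^-1).
  by have := rM _ _ _ _ (rF _ (rpred1 _)) (sP x); rewrite !mul1r.
have sM : {morph s : x y / x * y}.
  by move=> x y; apply: sE; have := rM _ _ _ _ (sP x) (sV y); rewrite !invrK.
have sadd : zmod_morphism s by [].
have smul : monoid_morphism s by [].
pose sr : {rmorphism Om -> Om} := HB.pack s
  (GRing.isZmodMorphism.Build Om Om s sadd) (GRing.isMonoidMorphism.Build Om Om s smul).
exists sr; split=> [c cF|u v uv]; first by apply: sE; exact: rF.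
by apply/sE/rr'.
Qed.

Lemma pemb_base_subproof : is_pemb [set uv | uv.1 \in F /\ uv.1 = uv.2].
Proof.
split=> //=.
- by move=> u v u' v' [uF <-] [u'F <-]; split=> //; exact: rpredB.
- by move=> u v u' v' [uF <-] [u'F <-]; split=> //; exact: rpred_div.
- by move=> v [].
Qed.

Definition pemb_base := Pemb pemb_base_subproof.

(** The base field is the fixed field of the endomorphisms over it, since a minimal
    polynomial of degree at least 2 has two distinct roots. *)
Lemma base_fixed x : (forall s : {rmorphism Om -> Om},
  (forall c, c \in F -> s c = c) -> s x = x) -> x \in F.
Proof.
move=> fx.
have [m [mP m0 msep]] := minimal_poly pemb_base (sepOm.1 x).
have pv : pfun_lift m = pdom_lift m.
  by apply: eq_map_poly => c; have [] := pfunP c.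
have mx : root (pdom_lift m) x by rewrite mP dvdpp.
have [q mq] := factor_theorem _ _ mx.
rewrite pv mq separable_mul in msep; case/and3P: msep => qsep _ qX.
have qx : ~~ root q x by rewrite -coprimep_XsubC.
have q0 : q != 0 by apply: contraNneq qx => ->; rewrite root0.
have [q1|q1] := leqP (size q) 1; last first.
  have [y qy] := sepOm.2 _ qsep q1.
  have [|r' [_ r'xy]] := pemb_adjoin (y := y) mP m0; first by rewrite pv mq rootM qy.
  have [s [sF sr']] := pemb_extend r'.
  by move: qy; rewrite -(sr' _ _ r'xy) (fx s sF) (negbTE qx).
have szm : size m = 2%N.
  have <- : size (pdom_lift m) = size m by rewrite size_map_poly.
  rewrite mq size_mul ?polyXsubC_eq0 // size_XsubC addn2 /=.
  have : (0 < size q)%N by rewrite size_poly_gt0.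
  by case: (size q) q1 => [|[]].
have inF (c : subfield_type (pdom pemb_base)) : val c \in F by have [] := pfunP c.
have m1 : m`_1 != 0 by have := lead_coef_eq0 m; rewrite lead_coefE szm /= => ->.
have : (pdom_lift m).[x] = val m`_0 + val m`_1 * x.
  rewrite horner_coef size_map_poly szm !big_ord_recl big_ord0 /= !coef_map /=.
  by rewrite expr0 mulr1 addr0 expr1.
rewrite (rootP mx) => /esym/eqP; rewrite addrC addr_eq0 => /eqP e.
have -> : x = - val m`_0 / val m`_1.
  by rewrite -e mulrAC mulfV ?mul1r // fmorph_eq0.
by rewrite rpred_div // rpredN.
Qed.

End PartialEmbeddings.

(** * Galois groups as topological groups *)

Section GaloisGroups.
Variables (Om : fieldType) (K M : divringClosed Om).
Notation KT := (subfield_type K).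
Implicit Types (s t : gal K M) (x y : KT).

Lemma gal_zmod_morphism s : zmod_morphism s.
Proof.
have [s1 sD sM _ _] := galP s.
move=> x y; apply: (addIr (s y)); rewrite -sD !subrK //.
Qed.

Lemma gal_monoid_morphism s : monoid_morphism s.
Proof. by have [s1 sD sM _ _] := galP s; split. Qed.

HB.instance Definition _ s :=
  GRing.isZmodMorphism.Build KT KT (gal_fun s) (gal_zmod_morphism s).
HB.instance Definition _ s :=
  GRing.isMonoidMorphism.Build KT KT (gal_fun s) (gal_monoid_morphism s).

Lemma gal_expg s n x : (s ^+ n)%g x = iter n s x.
Proof. by elim: n => [|n IH] //=; rewrite expgS -IH. Qed.

Lemma gal_base s x : val x \in M -> s x = x.
Proof. by have [_ _ _ _] := galP s; apply. Qed.

Lemma gal_invE s x : s (gal_inv s x) = x.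
Proof. exact: gal_invK. Qed.

Lemma gal_nbhs s (X : seq KT) : nbhs s [set t : gal K M | {in X, t =1 s}].
Proof. by apply/gal_nbhsP; exists X. Qed.

Definition finite_orbits :=
  forall x, exists rs : seq KT, forall s, s x \in rs.

Lemma gal_fixer_open (X : seq KT) : open [set s : gal K M | forall x, x \in X -> s x = x].
Proof.
rewrite openE => s /= sX; apply/gal_nbhsP; exists X => t ts x xX.
by rewrite ts // sX.
Qed.

(** Along an ultrafilter of automorphisms the value at each point is eventually
    constant, since it takes finitely many values. *)
Lemma gal_compact : finite_orbits -> compact [set: gal K M].
Proof.
move=> fin; rewrite compact_ultra => U UU _.
have pU : ProperFilter U by exact: ultra_proper.
have pick (V : gal K M -> KT) (rs : seq KT) :
    U [set s | V s \in rs] -> exists y, U [set s | V s = y].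
  elim: rs => [|y rs IH]; first by move=> /filter_ex[].
  move=> Uyrs; have [Uy|nUy] := in_ultra_setVsetC [set s | V s = y] UU; first by exists y.
  apply: IH; apply: filterS2 Uyrs nUy => s /=.
  by rewrite inE => /orP[/eqP|].
have evf x : exists y, U [set s : gal K M | s x = y].
  have [rs rsx] := fin x; apply: (pick (fun s => s x) rs).
  by apply: filterS filterT => s _; exact: rsx.
have evg x : exists y, U [set s | gal_inv s x = y].
  have [rs rsx] := fin x; apply: (pick (fun s => gal_inv s x) rs).
  by apply: filterS filterT => s _; exact: rsx.
have [f fU] := choice evf; have [g gU] := choice evg.
have fa : is_automorphism M f.
  split.
  - have [s /= <-] := filter_ex (fU 1); exact: rmorph1.
  - move=> x y.
    have [s [[/= <- <-] <-]] := filter_ex (filterI (filterI (fU x) (fU y)) (fU (x + y))).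
    exact: rmorphD.
  - move=> x y.
    have [s [[/= <- <-] <-]] := filter_ex (filterI (filterI (fU x) (fU y)) (fU (x * y))).
    exact: rmorphM.
  - exists g => x.
      have [s [/= + <-]] := filter_ex (filterI (fU x) (gU (f x))).
      by move=> <-; exact: gal_funK.
    have [s [/= + <-]] := filter_ex (filterI (gU x) (fU (g x))).
    by move=> <-; exact: gal_invE.
  - move=> x xM; have [s /= <-] := filter_ex (fU x); exact: gal_base.
exists (Gal (introT (asboolP _) fa)); split=> // A /gal_nbhsP[X XA].
suff : U [set t : gal K M | {in X, t =1 f}] by apply: filterS => t; exact: XA.
elim: X {XA} => [|x X IH]; first by apply: filterS filterT.
apply: filterS2 (fU x) IH => t /= tx tX z; rewrite inE => /orP[/eqP -> //|]; exact: tX.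
Qed.

Lemma gal_hausdorff : hausdorff_space (gal K M).
Proof.
move=> s t st; apply: gal_ext => x.
have [u [/= us ut]] := st _ _ (gal_nbhs s [:: x]) (gal_nbhs t [:: x]).
by rewrite -us ?inE // ut ?inE.
Qed.

Lemma gal_totally_disconnected : totally_disconnected [set: gal K M].
Proof.
apply: zero_dimension_totally_disconnected => s t st.
have [x sx] : exists x, s x != t x.
  apply: contrapT => nx; case/eqP: st; apply: gal_ext => x; apply/eqP.
  by apply: contraT => sx; case: nx; exists x.
exists [set u : gal K M | u x = s x]; split=> //; last by move=> /= tx; rewrite tx eqxx in sx.
split; [|rewrite -openC]; rewrite openE => u /= ux; apply/gal_nbhsP; exists [:: x] => v vu;
  by rewrite /= vu ?inE.
Qed.

Lemma iter_pow2_seq s (X : seq KT) :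
  (forall x, exists k, iter (2 ^ k) s x = x) ->
  exists k, forall x, x \in X -> iter (2 ^ k) s x = x.
Proof.
move=> sP; elim: X => [|y X [k kX]]; first by exists 0%N.
have [l ly] := sP y; exists (k + l)%N => x.
rewrite expnD inE => /orP[/eqP ->|xX]; first by rewrite iterM iter_fix.
by rewrite mulnC iterM iter_fix // kX.
Qed.

Lemma gal_pro2 : finite_orbits -> (forall s x, exists k, iter (2 ^ k) s x = x) ->
  pro2 (gal K M).
Proof.
move=> fin pow; have cG := gal_compact fin.
split=> //; [exact: gal_hausdorff|exact: gal_totally_disconnected|].
move=> N oN nN; have [sN _] := nN; have [d iN] := compact_open_index cG oN sN.
have [s|k dk] := index_pow2 nN iN; last by exists k; rewrite -dk.
have : nbhs 1%g N by apply: open_nbhs_nbhs; split=> //; case: sN.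
move=> /gal_nbhsP[X XN]; have [k kX] := iter_pow2_seq X (pow s).
by exists k; apply: XN => x xX; rewrite gal_expg kX.
Qed.

(** The automorphisms fixing all conjugates of [x] form a normal subgroup, which is
    open because the orbit of [x] is finite; Lagrange's theorem applies to it. *)
Lemma pro2_gal_pow : finite_orbits -> pro2 (gal K M) -> forall s x,
  exists k, iter (2 ^ k) s x = x.
Proof.
move=> fin [_ _ _ iG] s x.
pose N := [set t : gal K M | forall u : gal K M, t (u x) = u x].
have nN : normal_subgroup N.
  split; first split=> [u|t t' Nt Nt' u|t Nt u] //=.
  - by rewrite Nt' Nt.
  - by rewrite -{1}(Nt u) gal_funK.
  - move=> t t' Nt u /=; have := Nt (t' * u)%g => /= ->.
    exact: gal_funK.
have oN : open N.
  have [rs rsx] := fin x.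
  pose X := [seq y <- rs | `[< exists u : gal K M, u x = y >]].
  rewrite (_ : N = [set t : gal K M | forall y, y \in X -> t y = y]).
    exact: gal_fixer_open.
  apply/seteqP; split=> t Nt.
    by move=> y; rewrite mem_filter => /andP[/asboolP[u <-] _]; exact: Nt.
  by move=> u; apply: Nt; rewrite mem_filter rsx andbT; apply/asboolP; exists u.
have [k iN] := iG N oN nN; exists k.
by rewrite -gal_expg; have := index_pow_mem nN s iN => /(_ 1%g).
Qed.

(** Artin's lemma in the form of a density statement: an endomorphism fixing the
    fixed field of [B] agrees with an element of [B] on any finite list [X]. The
    polynomial with coefficients [X] has finitely many conjugates under [B], the
    monic polynomial having them as roots has coefficients fixed by [B], and so it
    is fixed by the endomorphism as well. *)
Lemma fixed_field_density (B : set (gal K M)) (f : {rmorphism KT -> KT}) :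
  B 1%g -> (forall s t, B s -> B t -> B (s * t)%g) -> finite_orbits ->
  (forall x, (forall s, B s -> s x = x) -> f x = x) ->
  forall X : seq KT, exists2 s, B s & {in X, s =1 f}.
Proof.
move=> B1 BM fin fB X.
have finc (Y : seq KT) : finite_set [set map_poly s (Poly Y) | s in B].
  elim: Y => [|x Y IH] /=.
    apply: (@sub_finite_set _ _ [set 0]); last exact: finite_set1.
    by move=> _ [s _ <-] /=; rewrite rmorph0.
  have [rs rsx] := fin x.
  apply: (@sub_finite_set _ _ [set cons_poly y p | y in [set` rs] &
     p in [set map_poly s (Poly Y) | s in B]]).
    move=> _ [s Bs <-]; exists (s x); first exact: rsx.
    exists (map_poly s (Poly Y)); first by exists s.
    by rewrite !cons_poly_def rmorphD rmorphM /= map_polyX map_polyC.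
  by apply: finite_image2 => //; exact: finite_seq.
have [zs0 zs0E] := (finite_seqP _).1 (finc X).
pose zs := undup zs0.
have zsP p : p \in zs <-> exists2 s, B s & map_poly s (Poly X) = p.
  by rewrite mem_undup; have -> : (p \in zs0) = [set` zs0] p :> Prop by []; rewrite -zs0E.
pose Q : {poly {poly KT}} := \prod_(z <- zs) ('X - z%:P).
have QB s : B s -> map_poly (map_poly s) Q = Q.
  move=> Bs; rewrite /Q rmorph_prod /=.
  under eq_bigr do rewrite map_polyXsubC.
  rewrite -(big_map (map_poly s) predT (fun z => 'X - z%:P)); apply: perm_big.
  have us : uniq (map (map_poly s) zs).
    by rewrite map_inj_uniq ?undup_uniq //; exact: map_poly_inj.
  apply: uniq_perm => //; first exact: undup_uniq.
  apply: (uniq_min_size us _ _).2; last by rewrite size_map.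
  move=> _ /mapP[z /zsP[t Bt <-] ->]; apply/zsP; exists (s * t)%g; first exact: BM.
  by apply/polyP => i; rewrite !coef_map.
have Qf : map_poly (map_poly f) Q = Q.
  apply/polyP => i; apply/polyP => j; rewrite !coef_map /=.
  by apply: fB => s /QB QE; rewrite -{2}QE !coef_map.
have Qq : root Q (Poly X).
  rewrite root_prod_XsubC; apply/zsP; exists 1%g => //.
  by apply/polyP => i; rewrite coef_map.
have : root Q (map_poly f (Poly X)).
  by rewrite -Qf /root horner_map (rootP Qq) rmorph0.
rewrite root_prod_XsubC => /zsP[s Bs sX]; exists s => // x xX.
have := congr1 (fun p : {poly KT} => p`_(index x X)) sX.
by rewrite !coef_map !coef_Poly nth_index.
Qed.

End GaloisGroups.

(** * The maximal 2-extension *)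

Lemma finite_roots (R : fieldType) (p : {poly R}) : p != 0 ->
  exists rs : seq R, forall x, (x \in rs) = root p x.
Proof.
have [n] := ubnP (size p); elim: n p => // n IH p pn p0.
have [[x px]|nr] := pselect (exists x, root p x); last first.
  by exists [::] => x; apply/esym/negbTE/negP => px; apply: nr; exists x.
have [q pq] := factor_theorem _ _ px.
have q0 : q != 0 by apply: contraNneq p0 => q0; rewrite pq q0 mul0r.
have [|rs rsP] := IH q _ q0.
  by move: pn; rewrite pq size_mul ?polyXsubC_eq0 // size_XsubC addn2.
by exists (x :: rs) => y; rewrite inE rsP pq rootM root_XsubC orbC.
Qed.

Section MaximalTwoExtension.
Variables (Om : fieldType) (F : divringClosed Om).
Hypothesis sepOm : separable_closure F.
Implicit Types s t : {rmorphism Om -> Om}.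

Definition fixes_base s := forall c, c \in F -> s c = c.

Lemma fixes_base_lift s (p : {poly subfield_type F}) :
  fixes_base s -> map_poly s (lift_poly p) = lift_poly p.
Proof. by move=> sF; apply/polyP => i; rewrite !coef_map /=; apply: sF; exact: valP. Qed.

Lemma fixes_base_root s (p : {poly subfield_type F}) x :
  fixes_base s -> root (lift_poly p) x -> root (lift_poly p) (s x).
Proof.
by move=> sF px; rewrite -(fixes_base_lift p sF) /root horner_map (rootP px) rmorph0.
Qed.

(** The conjugates of an element lie among the roots of a polynomial over [F]. *)
Lemma conjugates_finite x : exists2 rs : seq Om,
  x \in rs & forall s y, fixes_base s -> y \in rs -> s y \in rs.
Proof.
have [p psep px] := sepOm.1 x.
have p0 : lift_poly p != 0.
  by rewrite /lift_poly map_poly_eq0; exact: separable_poly_neq0.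
have [rs rsP] := finite_roots p0.
by exists rs => [|s y sF]; rewrite !rsP //; exact: fixes_base_root.
Qed.

Lemma perm_conjugates s (rs : seq Om) : uniq rs -> (forall y, y \in rs -> s y \in rs) ->
  perm_eq (map s rs) rs.
Proof.
move=> us srs; have um : uniq (map s rs) by rewrite map_inj_uniq //; exact: fmorph_inj.
apply: uniq_perm => //; apply: (uniq_min_size um _ _).2; last by rewrite size_map.
by move=> _ /mapP[y yrs ->]; exact: srs.
Qed.

(** An endomorphism permutes the finitely many conjugates of each element. *)
Lemma fixes_base_inv s : fixes_base s ->
  exists2 t, fixes_base t & cancel s t /\ cancel t s.
Proof.
move=> sF.
have surj x : exists y, s y = x.
  have [rs xrs rsP] := conjugates_finite x.
  have /perm_mem/(_ x) : perm_eq (map s (undup rs)) (undup rs).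
    by apply: perm_conjugates => [|y]; rewrite ?undup_uniq // !mem_undup; exact: rsP.
  by rewrite mem_undup xrs => /mapP[y _ ->]; exists y.
have [t ts] := choice surj.
have st : cancel s t by move=> x; apply: (fmorph_inj s); rewrite ts.
have tB : zmod_morphism t by move=> x y; apply: (fmorph_inj s); rewrite rmorphB !ts.
have tM : monoid_morphism t.
  by split=> [|x y]; apply: (fmorph_inj s); rewrite ?rmorph1 ?rmorphM !ts.
pose tr : {rmorphism Om -> Om} := HB.pack t
  (GRing.isZmodMorphism.Build Om Om t tB) (GRing.isMonoidMorphism.Build Om Om t tM).
exists tr; last by split.
by move=> c cF; apply: (fmorph_inj s); rewrite [RHS]sF //; exact: ts.
Qed.

(** An intrinsic description of the maximal 2-extension, as [mem_max_2ext] shows; it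
    makes closure under square roots immediate. *)
Definition two_power_orbits : {pred Om} := fun x =>
  `[< forall s, fixes_base s -> exists k, iter (2 ^ k) s x = x >].

Lemma two_power_orbitsP x : reflect
  (forall s, fixes_base s -> exists k, iter (2 ^ k) s x = x) (x \in two_power_orbits).
Proof. exact: asboolP. Qed.

Lemma iter_rmorphB s n : {morph iter n s : x y / x - y}.
Proof. by move=> x y; elim: n => //= n ->; rewrite rmorphB. Qed.

Lemma iter_rmorph_div s n : {morph iter n s : x y / x / y}.
Proof. by move=> x y; elim: n => //= n ->; rewrite fmorph_div. Qed.

Lemma iter_pow2_common s x y k l : iter (2 ^ k) s x = x -> iter (2 ^ l) s y = y ->
  iter (2 ^ (k + l)) s x = x /\ iter (2 ^ (k + l)) s y = y.
Proof.
by move=> xk yl; rewrite expnD; split; [rewrite mulnC|]; rewrite iterM iter_fix.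
Qed.

Lemma two_power_orbits_divring_closed : divring_closed two_power_orbits.
Proof.
split=> [|x y /two_power_orbitsP xP /two_power_orbitsP yP|
          x y /two_power_orbitsP xP /two_power_orbitsP yP]; apply/two_power_orbitsP => s sF.
- by exists 0%N; rewrite /= rmorph1.
- have [[k xk] [l yl]] := (xP s sF, yP s sF); exists (k + l)%N.
  by rewrite iter_rmorphB; have [-> ->] := iter_pow2_common xk yl.
- have [[k xk] [l yl]] := (xP s sF, yP s sF); exists (k + l)%N.
  by rewrite iter_rmorph_div; have [-> ->] := iter_pow2_common xk yl.
Qed.

HB.instance Definition _ := GRing.isDivringClosed.Build Om two_power_orbits
  two_power_orbits_divring_closed.

Lemma two_power_orbits_stable s x : fixes_base s ->
  x \in two_power_orbits -> s x \in two_power_orbits.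
Proof.
move=> sF /two_power_orbitsP xP; apply/two_power_orbitsP => t tF.
have [s' s'F [ss' s's]] := fixes_base_inv sF.
pose u : {rmorphism Om -> Om} := s' \o (t \o s).
have [|k xk] := xP u; first by move=> c cF /=; rewrite sF // tF // s'F.
exists k.
have su n y : s (iter n u y) = iter n t (s y) by elim: n => //= n <-; rewrite s's.
by rewrite -su xk.
Qed.

Lemma base_two_power_orbits : {subset F <= two_power_orbits}.
Proof. by move=> c cF; apply/two_power_orbitsP => s sF; exists 0%N; rewrite /= sF. Qed.

(** The graph of an automorphism is a partial embedding. *)
Lemma gal_extend (K : divringClosed Om) (g : gal K F) : {subset F <= K} ->
  exists2 s, fixes_base s & forall x : subfield_type K, s (val x) = val (g x).
Proof.
move=> FK.
have gP : is_pemb F [set uv | exists x : subfield_type K, uv = (val x, val (g x))].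
  split.
  - move=> c cF; exists (SubfieldElt (FK c cF)); rewrite gal_base //.
  - by move=> u v u' v' [x [-> ->]] [y [-> ->]]; exists (x - y); rewrite !rmorphB.
  - by move=> u v u' v' [x [-> ->]] [y [-> ->]]; exists (x / y); rewrite !fmorph_div.
  - move=> v [x [x0 ->]]; have -> : x = 0 by apply: val_inj.
    by rewrite !raddf0.
have [s [sF sg]] := pemb_extend sepOm (Pemb gP).
by exists s => // x; apply: sg; exists x.
Qed.

Lemma gal_restrict (K : divringClosed Om) s :
  (forall t x, fixes_base t -> x \in K -> t x \in K) -> fixes_base s ->
  exists g : gal K F, forall x : subfield_type K, val (g x) = s (val x).
Proof.
move=> stab sF; have [s' s'F [ss' s's]] := fixes_base_inv sF.
pose g (x : subfield_type K) : subfield_type K := SubfieldElt (stab s _ sF (valP x)).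
pose g' (x : subfield_type K) : subfield_type K := SubfieldElt (stab s' _ s'F (valP x)).
have gP : is_automorphism F g.
  split.
  - by apply: val_inj; rewrite /= rmorph1.
  - by move=> x y; apply: val_inj; rewrite /= rmorphD.
  - by move=> x y; apply: val_inj; rewrite /= rmorphM.
  - by exists g' => x; apply: val_inj; [exact: ss'|exact: s's].
  - by move=> x xF; apply: val_inj; exact: (sF _ xF).
by exists (Gal (introT (asboolP _) gP)).
Qed.

Lemma gal_finite_orbits (K : divringClosed Om) : {subset F <= K} ->
  finite_orbits K F.
Proof.
move=> FK x; have [rs xrs rsP] := conjugates_finite (val x).
exists (pmap insub rs : seq (subfield_type K)) => g.
rewrite mem_pmap_sub; have [s sF <-] := gal_extend g FK.
exact: rsP.
Qed.

Lemma irreducible_over x : exists2 p : {poly subfield_type F},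
  irreducible_poly p & root (lift_poly p) x.
Proof.
have [f fsep fx] := sepOm.1 x.
pose good n := `[< exists p : {poly subfield_type F},
  [/\ p != 0, root (lift_poly p) x & size p = n] >].
have exn : exists n, good n.
  by exists (size f); apply/asboolP; exists f; split=> //; exact: separable_poly_neq0.
have [n /asboolP[p [p0 px ps]] nmin] := ex_minnP exn.
have pmin (q : {poly subfield_type F}) :
    q != 0 -> root (lift_poly q) x -> (size p <= size q)%N.
  by move=> q0 qx; rewrite ps; apply: nmin; apply/asboolP; exists q.
exists p => //; split.
  rewrite ltnNge; apply/negP => p1; move: px p0.
  rewrite (size1_polyC p1) /lift_poly map_polyC rootC fmorph_eq0 => /eqP ->.
  by rewrite eqxx.
move=> q q1 /[dup] qp /dvdpP[d pE].
have d0 : d != 0 by apply: contraNneq p0 => d0; rewrite pE d0 mul0r.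
have q0 : q != 0 by apply: contraNneq p0 => q0; rewrite pE q0 mulr0.
have : root (lift_poly d) x || root (lift_poly q) x.
  by rewrite -rootM -rmorphM -pE.
case/orP => [/(pmin _ d0)|/(pmin _ q0)] szp.
  case/eqP: q1; move: szp; rewrite pE size_mul //.
  have : (0 < size q)%N by rewrite size_poly_gt0.
  have : (0 < size d)%N by rewrite size_poly_gt0.
  by case: (size d) (size q) => [|a] [|[|b]] //; rewrite addSn /= !addnS !ltnS ltnNge leq_addr.
rewrite -(dvdp_size_eqp qp) eqn_leq szp andbT; exact: dvdp_leq.
Qed.

Lemma galois_stable (K : divringClosed Om) : galois_extension F K ->
  forall s x, fixes_base s -> x \in K -> s x \in K.
Proof.
move=> [_ _ nK] s x sF xK; have [p pirr px] := irreducible_over x.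
have [|rs rsK prs] := nK p pirr; first by exists x.
apply: rsK; rewrite -root_prod_XsubC -(eqp_root prs).
exact: fixes_base_root.
Qed.

Lemma two_extension_two_power_orbits (K : divringClosed Om) :
  two_extension F K -> {subset K <= two_power_orbits}.
Proof.
move=> [gK pK] x xK; apply/two_power_orbitsP => s sF.
have FK : {subset F <= K} by case: gK.
have [g gs] := gal_restrict (galois_stable gK) sF.
have [k gk] := pro2_gal_pow (gal_finite_orbits FK) pK g (SubfieldElt xK).
exists k; have : forall n (y : subfield_type K), val (iter n g y) = iter n s (val y).
  by elim=> [//|n IH y]; rewrite !iterS gs IH.
by move=> /(_ (2 ^ k)%N (SubfieldElt xK)); rewrite gk.
Qed.

Lemma gal_two_power (K : divringClosed Om) : {subset F <= K} ->
  {subset K <= two_power_orbits} -> pro2 (gal K F).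
Proof.
move=> FK K2; apply: gal_pro2 => [|g x]; first exact: gal_finite_orbits.
have [s sF sg] := gal_extend g FK.
have /two_power_orbitsP/(_ s sF)[k sk] := K2 _ (valP x).
exists k; apply: val_inj; rewrite -[RHS]sk.
by elim: (2 ^ k)%N => [//|n IH]; rewrite !iterS -IH sg.
Qed.

(** An irreducible polynomial with a root [x] divides the product of the linear
    factors of the conjugates of [x], whose coefficients are fixed and hence in [F]. *)
Lemma two_power_orbits_normal : normal_over F two_power_orbits.
Proof.
move=> p pirr [x xK px].
have [rs0 xrs0 rs0P] := conjugates_finite x.
pose rs := undup [seq y <- rs0 | y \in two_power_orbits].
have xrs : x \in rs by rewrite mem_undup mem_filter xK.
have rsP s y : fixes_base s -> y \in rs -> s y \in rs.
  move=> sF; rewrite !mem_undup !mem_filter => /andP[yK yrs].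
  by rewrite two_power_orbits_stable // rs0P.
pose q := \prod_(y <- rs) ('X - y%:P).
have qF i : q`_i \in F.
  apply: (base_fixed sepOm) => s sF.
  suff {2}<- : map_poly s q = q by rewrite coef_map.
  rewrite /q rmorph_prod /=; under eq_bigr do rewrite map_polyXsubC.
  rewrite -(big_map s predT (fun y => 'X - y%:P)); apply: perm_big.
  by apply: perm_conjugates; [exact: undup_uniq|move=> y; exact: rsP].
pose q' : {poly subfield_type F} := \poly_(i < size q) SubfieldElt (qF i).
have qE : lift_poly q' = q.
  apply/polyP => i; rewrite coef_map coef_poly; case: ltnP => [//|iq].
  by rewrite raddf0 nth_default.
have pq : p %| q'.
  have [psz pmin] := pirr.
  have gx : root (lift_poly (gcdp p q')) x.
    rewrite /lift_poly gcdp_map root_gcd -/(lift_poly p) px -/(lift_poly q') qE.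
    by rewrite root_prod_XsubC.
  have g1 : size (gcdp p q') != 1%N.
    apply: contraTneq gx => /eqP/size_poly1P[c c0 ->].
    by rewrite /lift_poly map_polyC rootC fmorph_eq0.
  by rewrite -(eqp_dvdl _ (pmin _ g1 (dvdp_gcdl _ _))) dvdp_gcdr.
have : lift_poly p %| \prod_(y <- rs) ('X - y%:P) by rewrite -/q -qE dvdp_map.
move=> /dvdp_prod_XsubC[m pm]; exists (mask m rs) => // y /mem_mask.
by rewrite mem_undup mem_filter => /andP[].
Qed.

(** The maximal 2-extension consists of the elements with orbits of 2-power length:
    these form a Galois extension whose finite quotients are 2-groups by Cauchy's
    theorem, and conversely Lagrange's theorem applies in every 2-extension. *)
Lemma mem_max_2ext x : (x \in max_2ext F) = (x \in two_power_orbits).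
Proof.
apply/asboolP/idP => [|xK N KN].
  by apply=> K; exact: two_extension_two_power_orbits.
apply: KN (xK); split.
  split; [exact: base_two_power_orbits|move=> y _; exact: sepOm.1|].
  exact: two_power_orbits_normal.
by apply: gal_two_power; [exact: base_two_power_orbits|].
Qed.

Lemma base_max_2ext : {subset F <= max_2ext F}.
Proof. by move=> x xF; rewrite mem_max_2ext; exact: base_two_power_orbits. Qed.

Lemma max_2ext_pro2 : pro2 (gal (max_2ext F) F).
Proof.
apply: gal_two_power; first exact: base_max_2ext.
by move=> x; rewrite mem_max_2ext.
Qed.

(** If [s ^ (2 ^ k)] fixes [x], it multiplies a square root of [x] by a sign, so that its
    square fixes the root. *)
Lemma max_2ext_sqrt (x : Om) : 2%N \notin [pchar Om] -> x \in max_2ext F ->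
  exists2 y, y \in max_2ext F & y ^+ 2 = x.
Proof.
move=> char2; have two0 : 2%:R != 0 :> Om by move: char2; rewrite inE.
have [-> _|x0] := eqVneq x 0.
  by exists 0; [exact: rpred0|rewrite expr0n].
rewrite mem_max_2ext => /two_power_orbitsP xP.
have [||y] := sepOm.2 ('X^2 - x%:P).
- rewrite unlock derivB derivC subr0 derivXn expr1 -scaler_nat coprimepZr //.
  by rewrite -['X]subr0 -polyC0 coprimep_XsubC /root !hornerE oppr0 expr0n sub0r oppr_eq0.
- by rewrite size_XnsubC.
rewrite /root !hornerE subr_eq0 => /eqP yx; exists y => //.
rewrite mem_max_2ext; apply/two_power_orbitsP => s sF.
have [k xk] := xP s sF; exists k.+1.
have itM n : {morph iter n s : u v / u * v}.
  by move=> u v; elim: n => //= n ->; rewrite rmorphM.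
have itN n u : iter n s (- u) = - iter n s u by elim: n => //= n ->; rewrite rmorphN.
have : iter (2 ^ k) s y ^+ 2 = y ^+ 2.
  by rewrite yx -[RHS]xk -yx !expr2 itM.
rewrite expnS iterM /=; move=> /eqP; rewrite eqf_sqr => /orP[]/eqP e; first by rewrite !e.
by rewrite e itN e opprK.
Qed.

End MaximalTwoExtension.

(** * Kummer theory and the Kaplansky radical *)

Section Sign.
Variable R : fieldType.
Hypothesis two0 : 2%:R != 0 :> R.
Implicit Types x y : R.

Lemma sign_neq (b : bool) y : y != 0 -> ((-1) ^+ b * y != y) = b.
Proof.
move=> y0; case: b; rewrite ?expr0 ?expr1 ?mul1r ?eqxx // mulN1r.
by rewrite eq_sym -addr_eq0 -mulr2n -mulr_natl mulf_eq0 negb_or two0.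
Qed.

Lemma sign_sqr x y : x ^+ 2 = y ^+ 2 -> x = (-1) ^+ (x != y) * y.
Proof.
move=> /eqP; rewrite eqf_sqr; have [-> _|xy /= /eqP ->] := eqVneq x y.
  by rewrite expr0 mul1r.
by rewrite expr1 mulN1r.
Qed.
End Sign.

Lemma natrF2_addb (a b : bool) : (a (+) b)%:R = a%:R + b%:R :> 'F_2.
Proof. by case: a; case: b; apply: val_inj. Qed.

Section Kummer.
Variables (Om : fieldType) (K H : divringClosed Om).
Notation KT := (subfield_type K).
Notation HT := (subfield_type H).
Hypothesis HK : {subset H <= K}.
Hypothesis char2 : 2%N \notin [pchar Om].
Hypothesis sqrtK : forall x, x \in K -> exists2 y, y \in K & y ^+ 2 = x.
Hypothesis fixH : forall x : KT, (forall s : gal K H, s x = x) -> val x \in H.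
Hypothesis finH : finite_orbits K H.
Implicit Types (s t : gal K H) (x y : KT).

Lemma two_neq0 : 2%:R != 0 :> KT.
Proof.
rewrite -(fmorph_eq0 (val : {rmorphism KT -> Om})) rmorph_nat.
by move: char2; rewrite inE.
Qed.

Definition incl (a : HT) : KT := SubfieldElt (HK (valP a)).

Lemma gal_incl s a : s (incl a) = incl a.
Proof. by apply: gal_base; exact: (valP a). Qed.

Lemma sqrt_ex x : exists y, y ^+ 2 = x.
Proof.
have [y yK yx] := sqrtK (valP x); exists (SubfieldElt yK).
by apply: val_inj; rewrite rmorphXn.
Qed.

(** Meant for a square root [x] of an element of [H]. *)
Definition kummer x : gal K H -> 'F_2 := fun s => (s x != x)%:R.

Lemma gal_sqrt s x : val (x ^+ 2) \in H -> s x = (-1) ^+ (s x != x) * x.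
Proof. by move=> xH; apply: sign_sqr; rewrite -rmorphXn; exact: gal_base. Qed.

Lemma gal_sign s b x : s ((-1) ^+ b * x) = (-1) ^+ b * s x.
Proof. by rewrite rmorphM rmorph_sign. Qed.

Lemma kummerP x : x != 0 -> val (x ^+ 2) \in H -> H1 (kummer x).
Proof.
move=> x0 xH; split=> [s A xA|s t].
  apply/gal_nbhsP; exists [:: x] => t ts.
  by rewrite /= /kummer ts ?inE //; exact: nbhs_singleton xA.
rewrite /kummer -natrF2_addb; congr (_%:R); congr nat_of_bool.
rewrite -[RHS](sign_neq two_neq0 _ x0); congr (_ != _).
transitivity (s ((-1) ^+ (t x != x) * x)); first by rewrite -gal_sqrt.
by rewrite gal_sign {1}(gal_sqrt s xH) mulrA -signr_addb addbC.
Qed.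

(** Kummer theory: every class is the character of a square root. The element is
    the difference of two conjugates of an element of the quadratic extension fixed
    by the kernel, which exists by density. *)
Lemma kummer_surjective psi : H1 psi ->
  exists x, [/\ x != 0, val (x ^+ 2) \in H & psi = kummer x].
Proof.
move=> [psic psiM].
have psi1 : psi 1%g = 0 by apply: (addrI (psi 1%g)); rewrite -psiM mulg1 addr0.
have psiV s : psi s^-1%g = psi s.
  by apply: (addIr (psi s)); rewrite -psiM mulVg psi1 addF2.
have [psi0|/existsNP[s0 ps0]] := pselect (forall s, psi s = 0).
  exists 1; split; [exact: oner_neq0|by rewrite expr1n rmorph1 rpred1|].
  by apply/funext => s; rewrite /kummer rmorph1 eqxx psi0.
have {}ps0 : psi s0 = 1 by case: (F2_cases (psi s0)).
have [y [yB ys0]] : exists y, (forall s, psi s = 0 -> s y = y) /\ s0 y <> y.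
  apply: contrapT => ny.
  have /gal_nbhsP[X XN] : nbhs (1%g : gal K H) [set s | psi s = 0].
    have := psic 1%g [set 0]; rewrite psi1 /= => /(_ _); rewrite nbhs_simpl; apply.
    exact: (@discrete_set1 (discrete_topology 'F_2)).
  have [||y yB|s sB sX] := @fixed_field_density _ _ _ [set s | psi s = 0] s0 _ _ finH _ X.
  - exact: psi1.
  - by move=> s t /= s1 t1; rewrite psiM s1 t1 addr0.
  - by apply: contrapT => ys; apply: ny; exists y.
  have : psi (s^-1 * s0)%g = 0.
    by apply: XN => x xX /=; rewrite -sX // gal_funK.
  by rewrite psiM psiV (sB : psi s = 0) ps0 add0r => /eqP; rewrite oner_eq0.
pose x := y - s0 y.
have x0 : x != 0 by rewrite subr_eq0 eq_sym; exact/eqP.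
have s0x : s0 x = - x.
  rewrite rmorphB opprB /=; congr (_ - _).
  by have := yB (s0 * s0)%g; rewrite psiM ps0 addF2 => /(_ erefl).
have sx s : psi s = 0 -> s x = x.
  move=> ps; rewrite /x rmorphB /= yB //; congr (_ - _).
  have /yB : psi (s0^-1 * s * s0)%g = 0 by rewrite !psiM psiV ps addr0 addF2.
  by move=> /(congr1 s0) /=; rewrite gal_invE.
have sx' s : psi s = 1 -> s x = - x.
  move=> ps; rewrite -s0x.
  have /sx : psi (s0^-1 * s)%g = 0 by rewrite psiM psiV ps ps0 addF2.
  by move=> /(congr1 s0) /=; rewrite gal_invE.
exists x; split=> //.
  apply: fixH => s; rewrite rmorphXn /=.
  by have [/sx ->|/sx' ->] := F2_cases (psi s); rewrite ?sqrrN.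
apply/funext => s; rewrite /kummer.
have [/[dup] /sx -> ->|/[dup] /sx' -> ->] := F2_cases (psi s); first by rewrite eqxx.
by rewrite -mulN1r -(expr1 (-1)) (sign_neq two_neq0 true).
Qed.

(** A norm equation [x ^ 2 = u ^ 2 - y ^ 2 v ^ 2] splits the cup product: a square
    root [d] of [u + y v] is multiplied by a sign, or sent to [x / d] up to sign,
    and these signs form the required cochain. *)
Lemma norm_cup (x y : KT) (u v : HT) : x != 0 -> val (x ^+ 2) \in H ->
  y != 0 -> val (y ^+ 2) \in H ->
  x ^+ 2 = incl u ^+ 2 - y ^+ 2 * incl v ^+ 2 ->
  coboundary2 (cup (kummer x) (kummer y)).
Proof.
move=> x0 xH y0 yH xE.
have [d dE] := sqrt_ex (incl u + y * incl v).
have zz : d ^+ 2 * (incl u - y * incl v) = x ^+ 2.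
  by rewrite dE xE mulrC -subr_sqr exprMn.
have d0 : d != 0.
  by apply: contraNneq x0 => d0; rewrite -sqrf_eq0 -zz d0 expr0n mul0r.
pose w s := if s y == y then d else x / d.
have w0 s : w s != 0 by rewrite /w; case: ifP; rewrite ?mulf_neq0 ?invr_eq0.
have sy_sign s : s y = (-1) ^+ (s y != y) * y by exact: gal_sqrt.
have dw s : s d = (-1) ^+ (s d != w s) * w s.
  apply: sign_sqr; rewrite -rmorphXn dE rmorphD rmorphM /= !gal_incl /w.
  have [->|sy] := eqVneq (s y) y; first by rewrite dE.
  rewrite sy_sign sy expr1 mulN1r mulNr expr_div_n -zz [d ^+ 2 * _]mulrC mulfK //.
  by rewrite sqrf_eq0.
exists (fun s => (s d != w s)%:R).
  move=> s A sA; apply/gal_nbhsP; exists [:: d; y] => t ts.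
  by rewrite /= /w !ts ?inE ?eqxx ?orbT //; exact: nbhs_singleton sA.
move=> s t; rewrite /cup /kummer /=.
have xw (r : gal K H) : x / w r = if r y == y then x / d else d.
  by rewrite /w; case: ifP => // _; rewrite invf_div mulrC divfK.
have wst : w (s * t)%g = if t y == y then w s else x / w s.
  have -> : w (s * t)%g = if s (t y) == y then d else x / d by [].
  rewrite xw /w; have -> : (s (t y) == y) = ((s y == y) == (t y == y)).
    have -> : s (t y) = (-1) ^+ ((t y != y) (+) (s y != y)) * y.
      by rewrite signr_addb -mulrA -sy_sign -gal_sign -sy_sign.
    rewrite -[LHS]negbK (sign_neq two_neq0 _ y0).
    by case: (t y == y); case: (s y == y).
  by case: (t y == y); case: (s y == y).
have sw : s (w t) = (-1) ^+ ((s d != w s) (+) ((s x != x) && (t y != y))) * w (s * t)%g.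
  rewrite wst {1}/w; case: ifP => ty; first by rewrite andbF addbF -dw.
  rewrite fmorph_div /= {1}(gal_sqrt s xH) {1}(dw s) andbT invfM invr_sign.
  by rewrite mulrACA signr_addb; congr (_ * _); rewrite mulrC.
have : (s * t)%g d != w (s * t)%g =
    (t d != w t) (+) ((s d != w s) (+) ((s x != x) && (t y != y))).
  rewrite -[RHS](sign_neq two_neq0 _ (w0 (s * t)%g)); congr (_ != _).
  by rewrite signr_addb -mulrA -sw -gal_sign -dw.
rewrite /= => ->; rewrite !natrF2_addb -natrM mulnb.
rewrite !opprD !addrA subrr add0r addrAC addNr add0r.
by apply/eqP; rewrite -addr_eq0 addF2.
Qed.

(** Apply the definition of the radical to the form [<1, - y ^ 2>] for each Kummer
    character [kummer y]. *)
Lemma kaplansky_radical_squares : cup_radical_trivial (gal K H) ->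
  kaplansky_radical HT = nonzero_squares HT.
Proof.
move=> rad; apply/seteqP; split=> [a aR|_ [x x0 <-] b b0]; last first.
  split; first by rewrite sqrf_eq0.
  by exists x, 0; rewrite expr0n mulr0 addr0.
have a0 : a != 0 by have [] := aR 1 (oner_neq0 _).
have [x xE] := sqrt_ex (incl a).
have incl0 (b : HT) : (incl b == 0) = (b == 0) by [].
have x0 : x != 0 by rewrite -sqrf_eq0 xE incl0.
have xH : val (x ^+ 2) \in H by rewrite xE; exact: (valP a).
have chi0 : forall s, kummer x s = 0.
  apply: rad => [|psi]; first exact: kummerP.
  move=> /kummer_surjective[y [y0 yH ->]].
  pose b : HT := SubfieldElt yH.
  have b0 : - b != 0.
    by rewrite oppr_eq0 -incl0 (_ : incl b = y ^+ 2) ?sqrf_eq0 //; exact: val_inj.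
  have [_ [u [v auv]]] := aR _ b0.
  apply: (norm_cup (u := u) (v := v)) => //.
  rewrite xE; apply: val_inj.
  transitivity (val u ^+ 2 - val y ^+ 2 * val v ^+ 2); last by [].
  by rewrite -mulNr; exact: (congr1 val auv).
have xfix s : s x = x.
  by apply/eqP; apply: contraT => sx; have := chi0 s; rewrite /kummer sx.
exists (SubfieldElt (fixH xfix)).
  by rewrite /=; apply: contraNneq x0 => /(congr1 val) /= x0; apply/eqP; exact: val_inj.
by apply: val_inj; have := congr1 val xE; rewrite rmorphXn /= => <-.
Qed.

End Kummer.

(** * The canonical character *)

Section CanonicalCharacter.
Variables (Om : fieldType) (K : divringClosed Om).
Notation KT := (subfield_type K).
Hypothesis two0 : 2%:R != 0 :> KT.
Hypothesis sqrtK : forall x : KT, exists y : KT, y ^+ 2 = x.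

Lemma two_power_prim_root n : exists z : KT, (2 ^ n).-primitive_root z.
Proof.
have rootN1 k : exists z : KT, z ^+ (2 ^ k) = -1.
  elim: k => [|k [z zk]]; first by exists (-1).
  by have [y yz] := sqrtK z; exists y; rewrite expnS exprM yz.
have [z [zn zn']] : exists z : KT, z ^+ (2 ^ n) = 1 /\
    forall k, (k < n)%N -> z ^+ (2 ^ k) != 1.
  case: n => [|n]; first by exists 1; rewrite expr1.
  have [z zn] := rootN1 n; exists z; split; first by rewrite expnSr exprM zn sqrrN expr1n.
  move=> k kn; apply/negP => /eqP zk; have := sign_neq two0 true (oner_neq0 KT).
  rewrite expr1 mulr1 -zn -(subnKC (kn : (k <= n)%N)) expnD exprM zk expr1n.
  by rewrite eqxx.
have [m zm] := prim_order_exists (expn_gt0 2 n : 0 < 2 ^ n)%N zn.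
move=> /dvdn_pfactor -/(_ isT)[k kn mk]; exists z; rewrite -(_ : m = 2 ^ n)%N // mk.
move: kn; rewrite leq_eqVlt => /orP[/eqP -> //|/zn'].
by rewrite -mk (prim_expr_order zm) eqxx.
Qed.

Section OneBase.
Variable M : divringClosed Om.
Implicit Types s t : gal K M.

(** An automorphism raises a primitive [2 ^ n]-th root of unity to some power; the
    exponents are coherent since such a root is also a [2 ^ n.+1]-th root of unity. *)
Lemma canonical_character_exists : exists theta : gal K M -> Z2, is_canonical_character theta.
Proof.
have [z zP] := choice two_power_prim_root.
have ex s n : exists k, s (z n) = z n ^+ k.
  have : s (z n) ^+ (2 ^ n) = 1.
    by rewrite -rmorphXn (prim_expr_order (zP n)) rmorph1.
  by move=> /(prim_rootP (zP n))[k ->]; exists k.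
have [e' e'P] := choice (fun sn : gal K M * nat => ex sn.1 sn.2).
pose e s n := e' (s, n).
have eP s n : s (z n) = z n ^+ e s n by exact: e'P (s, n).
have eE s n x : x ^+ (2 ^ n) = 1 -> s x = x ^+ e s n.
  move=> /(prim_rootP (zP n))[k ->].
  by rewrite rmorphXn /= eP -!exprM mulnC.
have zn m n : (m <= n)%N -> z m ^+ (2 ^ n) = 1.
  by move=> mn; rewrite -(subnKC mn) expnD exprM (prim_expr_order (zP m)) expr1n.
have co s n : (e s n.+1 = e s n %[mod 2 ^ n])%N.
  apply/eqP; rewrite -(eq_prim_root_expr (zP n)) -eP; apply/eqP/esym/eE.
  exact: zn.
pose theta s := mkZ2 (co s).
have thE s n : residue (theta s) n = (e s n %% 2 ^ n)%N by [].
exists theta; split; last first.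
  move=> s n x xn; rewrite thE (eE s n x xn).
  by rewrite expr_mod.
split.
- move=> s; apply/Z2_cvgP => n; apply/gal_nbhsP; exists [:: z n] => t ts.
  change (e t n = e s n %[mod 2 ^ n])%N; apply/eqP.
  rewrite -(eq_prim_root_expr (zP n)) -!eP.
  by rewrite ts ?inE.
- apply: residue_inj => n.
  change (e 1%g n = 1 %[mod 2 ^ n])%N; apply/eqP.
  by rewrite -(eq_prim_root_expr (zP n)) -eP.
- move=> s t; apply: residue_inj => n.
  change (e (s * t)%g n = (e s n %% 2 ^ n) * (e t n %% 2 ^ n) %[mod 2 ^ n])%N.
  apply/eqP; rewrite modnMm -(eq_prim_root_expr (zP n)) -eP exprM -eP.
  by rewrite /= eP rmorphXn /= eP -!exprM mulnC.
Qed.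

Lemma canonical_characterE s n (x : KT) : x ^+ (2 ^ n) = 1 ->
  s x = x ^+ residue (canonical_character s) n.
Proof.
have [_] : is_canonical_character (@canonical_character Om K M).
  by rewrite /canonical_character; apply: xgetPex; exact: canonical_character_exists.
by move=> H /H.
Qed.
End OneBase.

(** The residues of the character are determined by the action on primitive roots of
    unity, whatever the base field. *)
Lemma canonical_character_restrict (L M : divringClosed Om) (s : gal K L) (t : gal K M) :
  s =1 t -> canonical_character s = canonical_character t.
Proof.
move=> st; apply: residue_inj => n; have [z zP] := two_power_prim_root n.
have zn := prim_expr_order zP.
rewrite -(residue_mod (canonical_character s)) -(residue_mod (canonical_character t)).
apply/eqP; rewrite -(eq_prim_root_expr zP) -!canonical_characterE //; exact/eqP.
Qed.
End CanonicalCharacter.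

(** * Fixed fields of retracts *)

Section FixedField.
Variables (Om : fieldType) (K F : divringClosed Om).
Notation KT := (subfield_type K).
Hypothesis FK : {subset F <= K}.
Hypothesis finK : finite_orbits K F.
Variables (A : topGroupType) (i : A -> gal K F) (r : gal K F -> A).
Hypotheses (hi : continuous_hom i) (hr : continuous_hom r) (ir : cancel i r).

Definition fixed_field : {pred Om} :=
  fun x => `[< exists2 y : KT, val y = x & forall a, i a y = y >].

Lemma fixed_field_divring_closed : divring_closed fixed_field.
Proof.
split=> [|_ _ /asboolP[x <- xf] /asboolP[y <- yf]|_ _ /asboolP[x <- xf] /asboolP[y <- yf]];
  apply/asboolP.
- by exists 1 => // a; rewrite rmorph1.
- by exists (x - y) => // a; rewrite rmorphB /= xf yf.
- by exists (x / y) => // a; rewrite fmorph_div /= xf yf.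
Qed.

HB.instance Definition _ := GRing.isDivringClosed.Build Om fixed_field
  fixed_field_divring_closed.

Definition fixed_subfield : divringClosed Om := fixed_field.

Lemma base_fixed_field : {subset F <= fixed_field}.
Proof.
move=> c cF; apply/asboolP; exists (SubfieldElt (FK cF)) => // a.
exact: gal_base.
Qed.

Lemma fixed_field_sub : {subset fixed_field <= K}.
Proof. by move=> _ /asboolP[x <- _]; exact: valP. Qed.

Lemma fixed_fieldP (x : KT) : val x \in fixed_field <-> forall a, i a x = x.
Proof.
split=> [/asboolP[y /val_inj -> //]|xf]; by apply/asboolP; exists x.
Qed.

Fact gal_widen_subproof (s : gal K fixed_field) : is_automorphism F s.
Proof.
have [s1 sD sM sb sf] := galP s; split=> // x xF; apply: sf; exact: base_fixed_field.
Qed.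

Definition gal_widen (s : gal K fixed_field) : gal K F :=
  Gal (introT (asboolP _) (gal_widen_subproof s)).

Fact gal_of_subproof a : is_automorphism fixed_field (i a).
Proof.
have [s1 sD sM sb _] := galP (i a); split=> // x /fixed_fieldP; exact.
Qed.

Definition gal_of a : gal K fixed_field := Gal (introT (asboolP _) (gal_of_subproof a)).

Lemma gal_widen_hom : continuous_hom gal_widen.
Proof.
split=> [s U /gal_nbhsP[X XU]|s t]; last exact: gal_ext.
by apply/gal_nbhsP; exists X => t ts; apply: XU.
Qed.

Lemma gal_of_hom : continuous_hom gal_of.
Proof.
split=> [a U /gal_nbhsP[X XU]|a b]; last by apply: gal_ext => x /=; rewrite hi.2.
have ia := hi.1 a _ (gal_nbhs (i a) X).
by apply: (@filterS A (nbhs a) (nbhs_filter a) _ _ _ ia) => b ba; exact: (XU (gal_of b) ba).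
Qed.

Lemma gal_widen_of a : gal_widen (gal_of a) = i a.
Proof. exact: gal_ext. Qed.

(** The Galois correspondence for the closed subgroup [i @` A]: by density an
    automorphism fixing the fixed field is a limit of elements of the subgroup, and
    the retraction [r] makes the subgroup closed. *)
Lemma gal_widen_image s : i (r (gal_widen s)) = gal_widen s.
Proof.
apply: gal_ext => x; set g := gal_widen s.
have hir := continuous_hom_comp hr hi.
have /gal_nbhsP[X XU] := hir.1 g _ (gal_nbhs (i (r g)) [:: x]).
have [||y yf|_ [a _ <-] aX] := @fixed_field_density _ _ _ (range i) s _ _ finK _ (x :: X).
- by exists 1%g => //; exact: hom1 hi.2.
- by move=> _ _ [a _ <-] [b _ <-]; exists (a * b)%g => //; exact: hi.2.
- by apply: gal_base; apply/fixed_fieldP => a; apply: yf; exists a.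
have : {in X, i a =1 g} by move=> y yX; apply: aX; rewrite inE yX orbT.
move=> /XU /(_ x); rewrite /= ir inE eqxx => <- //.
by apply: aX; rewrite inE eqxx.
Qed.

Lemma gal_ofK : cancel gal_of (r \o gal_widen).
Proof. by move=> a; rewrite /= gal_widen_of ir. Qed.

Lemma gal_widenK : cancel (r \o gal_widen) gal_of.
Proof.
move=> s; apply: gal_ext => x.
by have := congr1 (fun g : gal K F => g x) (gal_widen_image s).
Qed.

Lemma fixed_field_iso : [/\ continuous_hom gal_of, continuous_hom (r \o gal_widen),
  cancel gal_of (r \o gal_widen) & cancel (r \o gal_widen) gal_of].
Proof.
split; [exact: gal_of_hom| |exact: gal_ofK|exact: gal_widenK].
exact: continuous_hom_comp gal_widen_hom hr.
Qed.

Lemma fixed_field_pro2 : pro2 A -> pro2 (gal K fixed_field).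
Proof.
by move=> pA; have [h1 h2 _ h4] := fixed_field_iso; exact: pro2_retract pA h2 h1 h4.
Qed.

Lemma fixed_field_coproduct : pro2_coproduct gal_of (fun _ : trivial_group => 1%g).
Proof. by have [h1 h2 h3 h4] := fixed_field_iso; exact: coproduct_iso_trivial h1 h2 h4 h3. Qed.

Lemma fixed_field_free : free_pro2 A -> free_pro2 (gal K fixed_field).
Proof.
move=> fA; have pA : pro2 A by case: fA => X [].
exact: (free_pro2_coproduct gal_of_hom (continuous_hom_cst _ _) (fixed_field_pro2 pA)
  fixed_field_coproduct fA trivial_group_free).
Qed.

Lemma fixed_field_cup_radical :
  cup_radical_trivial A -> cup_radical_trivial (gal K fixed_field).
Proof.
move=> rA.
exact: (cup_radical_trivial_coproduct gal_of_hom (continuous_hom_cst _ _)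
  fixed_field_coproduct rA trivial_group_cup_radical).
Qed.

Lemma fixed_field_fixed (x : KT) :
  (forall s : gal K fixed_field, s x = x) -> val x \in fixed_field.
Proof. by move=> xf; apply/fixed_fieldP => a; exact: (xf (gal_of a)). Qed.

Lemma fixed_field_orbits : finite_orbits K fixed_field.
Proof. by move=> x; have [rs rsP] := finK x; exists rs => s; exact: (rsP (gal_widen s)). Qed.

End FixedField.

Theorem theorem25 (Fs : fieldType) (F : divringClosed Fs)
    (charF : 2%N \notin [pchar Fs]%R) (closF : separable_closure F)
    (etF : elementary_type (galois_pair (max_2ext F) F)) :
  exists L H : divringClosed Fs,
    [/\ {subset F <= L} /\ {subset L <= max_2ext F},
        {subset F <= H} /\ {subset H <= max_2ext F},
        exists Q : cyclotomic_pair,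
          is_free_product (galois_pair (max_2ext F) L) (galois_pair (max_2ext F) H) Q /\
          pair_isomorphic (galois_pair (max_2ext F) F) Q,
        free_pro2 (gal (max_2ext F) L) &
        kaplansky_radical (subfield_type H) = nonzero_squares (subfield_type H)].
Proof.
have pG := max_2ext_pro2 closF.
have FK := base_max_2ext closF.
have finK := gal_finite_orbits closF FK.
have [A [B [i [j [[pA pB hi hj] univ fA rB]]]]] := elementary_type_decomposition etF pG.
have [r [hr ri _]] := coproduct_exists univ pA (continuous_hom_id A) (continuous_hom_cst B A).
have [q [hq _ qj]] := coproduct_exists univ pB (continuous_hom_cst A B) (continuous_hom_id B).
have sqrtK (x : Fs) : x \in max_2ext F -> exists2 y, y \in max_2ext F & y ^+ 2 = x.
  exact: max_2ext_sqrt.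
have two0 := two_neq0 (max_2ext F) charF.
have wchar (A' : topGroupType) (i' : A' -> gal (max_2ext F) F) :
    pair_morphism (gal_widen FK (i := i') :
      galois_pair (max_2ext F) (fixed_field i') -> galois_pair (max_2ext F) F).
  split; first exact: gal_widen_hom.
  by move=> s; apply: canonical_character_restrict => //; exact: sqrt_ex.
exists (fixed_subfield i), (fixed_subfield j); split.
- by split; [exact: base_fixed_field|exact: fixed_field_sub].
- by split; [exact: base_fixed_field|exact: fixed_field_sub].
- exists (galois_pair (max_2ext F) F); split; last first.
    exists id, id; split=> //; by split=> //; exact: continuous_hom_id.
  split=> //.
  + exact: (fixed_field_pro2 FK finK hi hr ri pA).
  + exact: (fixed_field_pro2 FK finK hj hq qj pB).
  exists (gal_widen FK (i := i)), (gal_widen FK (i := j)); split; [exact: wchar|exact: wchar|].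
  have [hai hra aiK raK] := fixed_field_iso FK finK hi hr ri.
  have [haj hqa ajK qaK] := fixed_field_iso FK finK hj hq qj.
  apply: pro2_coproductI => [T f f' pT hf hf' fi fj|T f1 f2 pT h1 h2].
    apply: (coproduct_ext hi hj univ pT hf hf') => a /=; rewrite -(gal_widen_of FK).
      exact: fi.
    exact: fj.
  have [f [hf fi fj]] := coproduct_exists univ pT
    (continuous_hom_comp hai h1) (continuous_hom_comp haj h2).
  exists f; split=> // s.
    by rewrite -[s]raK; have := fi (r (gal_widen FK s)); rewrite /= gal_widen_of.
  by rewrite -[s]qaK; have := fj (q (gal_widen FK s)); rewrite /= gal_widen_of.
- exact: (fixed_field_free FK finK hi hr ri fA).
- apply: (kaplansky_radical_squares (K := max_2ext F) _ charF sqrtK).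
  + exact: fixed_field_sub.
  + by move=> x; exact: fixed_field_fixed.
  + exact: (fixed_field_orbits FK finK).
  + exact: (fixed_field_cup_radical FK finK hj hq qj rB).
Qed.
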